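(* Consider the initial value problem for the Benjamin-Bona-Mahony equation $$\partial_t u+\partial_x u+u\partial_x u-\partial_x^2\partial_t u=0,\quad x,t\in\mathbb{R},\qquad u(x,0)=u_0(x).$$ Let $u_0\in H^s(\mathbb{R})$, $s\ge0$. If for some $k\in\mathbb{Z}^+\cup\{0\}$, $\theta\in[0,1)$ and $\Omega\subseteq\mathbb{R}$ open $$u_0\big|_{\Omega}\in C^{k+\theta},$$ then the corresponding solution $u\in C([0,T]:H^s(\mathbb{R}))$ of the initial value problem (described in the context) satisfies $$u(\cdot,t)\big|_{\Omega}\in C^{k+\theta}\quad\text{for all }t\in[0,T].$$ Moreover, $$u,\ \partial_t u\in C([0,T]:C^{k+\theta}(\Omega)).$$
   Context: The solution: by the well-posedness result of Bona and Tzvetkov, for any $u_0\in H^s(\mathbb{R})$, $s\ge0$, there exist $T=T(\|u_0\|_{s,2})>0$ (with $\|\cdot\|_{s,2}$ the $H^s(\mathbb{R})$ norm) and a unique solution $u\in C([0,T]:H^s(\mathbb{R}))$ of the initial value problem, and the map $u_0\mapsto u$ is locally continuous from $H^s(\mathbb{R})$ into $C([0,T]:H^s(\mathbb{R}))$. The equation is understood in the equivalent form $\partial_t u=-\partial_x(1-\partial_x^2)^{-1}(u+u^2/2)$, where $(1-\partial_x^2)^{-1}f=\frac12 e^{-|x|}*f$. $C^{k+\theta}(\Omega)$ denotes the functions that are $k$ times continuously differentiable on $\Omega$ with $k$-th derivative (locally) Hölder continuous of exponent $\theta$ if $\theta>0$ (for $\theta=0$ this is $C^k(\Omega)$), with the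 corresponding topology given by the $C^{k+\theta}$ norms on compact subsets of $\Omega$. Statements that an $L^2$ function is in $C^{k+\theta}$ on $\Omega$ refer to the existence of such a representative. *)

(* Defs.v *)
From HB Require Import structures.
From mathcomp Require Import all_boot all_order all_algebra.
From mathcomp Require Import all_classical all_reals all_analysis.

Set Implicit Arguments.
Unset Strict Implicit.
Unset Printing Implicit Defensive.

Import Order.TTheory GRing.Theory Num.Theory.
Import numFieldNormedType.Exports.

Local Open Scope classical_set_scope.
Local Open Scope ring_scope.

(* Elements of L^2(R) are represented by functions R -> R, and equality of
   classes by equality almost everywhere; curves in a space of functions are
   represented by maps t |-> (x |-> u t x). *)

Definition L2 (R : realType) (f : R -> R) : Prop :=
  f \in Lfun (@lebesgue_measure R) 2%:E.

Definition L2norm (R : realType) (f : R -> R) : \bar R :=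
  ('N[@lebesgue_measure R]_2%:E[EFin \o f])%E.

Definition ae_eq_on (R : realType) (Omega : set R) (f g : R -> R) : Prop :=
  {ae @lebesgue_measure R, forall x, Omega x -> f x = g x}.

(* Real and imaginary parts of
   (2 pi)^(-1/2) \int_(-n)^n f(x) exp(- i x xi) dx. *)
Definition fourier_trunc_re (R : realType) (f : R -> R) (n : nat) (xi : R) : R :=
  (Num.sqrt (2 * pi))^-1 *
  \int[@lebesgue_measure R]_(x in `[- n%:R, n%:R]) (f x * cos (x * xi)).

Definition fourier_trunc_im (R : realType) (f : R -> R) (n : nat) (xi : R) : R :=
  - (Num.sqrt (2 * pi))^-1 *
  \int[@lebesgue_measure R]_(x in `[- n%:R, n%:R]) (f x * sin (x * xi)).

(* [a + i b] is the Fourier transform of the L^2 function [f]: the limit in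
   L^2 of the transforms of the truncations of [f]. *)
Definition is_fourier (R : realType) (f a b : R -> R) : Prop :=
  [/\ L2 a, L2 b,
    L2norm (fourier_trunc_re f n \- a) @[n --> \oo] --> 0%E &
    L2norm (fourier_trunc_im f n \- b) @[n --> \oo] --> 0%E].

(* || (1 + xi^2)^(s/2) \hat f ||_2.  For [f] in L^2 the infimum is over one
   value, since the transform exists and is unique almost everywhere. *)
Definition Hs_norm (R : realType) (s : R) (f : R -> R) : \bar R :=
  ereal_inf [set N | exists a b : R -> R, is_fourier f a b /\
    N = L2norm (fun xi =>
          (1 + xi ^+ 2) `^ (s / 2) * Num.sqrt (a xi ^+ 2 + b xi ^+ 2))].

Definition Hs (R : realType) (s : R) (f : R -> R) : Prop :=
  L2 f /\ (Hs_norm s f < +oo)%E.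

Definition C_Hs (R : realType) (T s : R) (u : R -> R -> R) : Prop :=
  forall t0 : R, t0 \in `[0, T] -> Hs s (u t0) /\
    Hs_norm s (u t \- u t0) @[t --> within `[0, T] (nbhs t0)] --> 0%E.

(* [v] is the derivative of the curve [u : [0, T] -> L^2(R)], one-sided at the
   endpoints. *)
Definition L2_time_derivative (R : realType) (T : R) (u v : R -> R -> R) : Prop :=
  forall t0 : R, t0 \in `[0, T] -> L2 (v t0) /\
    L2norm (fun x => (t - t0)^-1 * (u t x - u t0 x) - v t0 x)
      @[t --> within `[0, T] t0^'] --> 0%E.

(* (1 - d_x^2)^-1 f = (1/2) exp(-|x|) * f *)
Definition helmholtz_inv (R : realType) (f : R -> R) (x : R) : R :=
  \int[@lebesgue_measure R]_y (2^-1 * expR (- `|x - y|) * f y).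

Definition bbm_rhs (R : realType) (f : R -> R) (x : R) : R :=
  - derive1 (helmholtz_inv (fun y => f y + f y ^+ 2 / 2)) x.

Definition bbm_solution (R : realType) (T s : R) (u0 : R -> R)
    (u : R -> R -> R) : Prop :=
  [/\ C_Hs T s u,
      ae_eq_on setT (u 0) u0 &
      L2_time_derivative T u (fun t => bbm_rhs (u t))].

Definition sup_norm (R : realType) (K : set R) (f : R -> R) : \bar R :=
  ereal_sup [set `|f x|%:E | x in K].

(* The diagonal contributes 0, as 0 / 0 = 0. *)
Definition holder_seminorm (R : realType) (theta : R) (K : set R)
    (f : R -> R) : \bar R :=
  ereal_sup [set (`|f x - f y| / `|x - y| `^ theta)%:E | x in K & y in K].

Definition Cktheta_norm (R : realType) (k : nat) (theta : R) (K : set R)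
    (f : R -> R) : \bar R :=
  (\sum_(j < k.+1) sup_norm K (derive1n j f) +
   (if (0 < theta)%R then holder_seminorm theta K (derive1n k f) else 0))%E.

Definition Cktheta (R : realType) (k : nat) (theta : R) (Omega : set R)
    (f : R -> R) : Prop :=
  [/\ forall j x, (j < k)%N -> Omega x -> derivable (derive1n j f) x 1,
      forall x, Omega x -> {for x, continuous (derive1n k f)} &
      0 < theta -> forall K, compact K -> K `<=` Omega ->
        (holder_seminorm theta K (derive1n k f) < +oo)%E].

Definition has_Cktheta_rep (R : realType) (k : nat) (theta : R) (Omega : set R)
    (f : R -> R) : Prop :=
  exists2 g : R -> R, Cktheta k theta Omega g & ae_eq_on Omega f g.

(* Continuity for the topology of C^(k+theta)(Omega) defined by the seminorms
   [Cktheta_norm k theta K], [K] a compact subset of [Omega]. *)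
Definition C_Cktheta (R : realType) (T : R) (k : nat) (theta : R)
    (Omega : set R) (u : R -> R -> R) : Prop :=
  exists U : R -> R -> R, forall t0 : R, t0 \in `[0, T] ->
    [/\ Cktheta k theta Omega (U t0),
        ae_eq_on Omega (u t0) (U t0) &
        forall K, compact K -> K !=set0 -> K `<=` Omega ->
          Cktheta_norm k theta K (U t \- U t0)
            @[t --> within `[0, T] (nbhs t0)] --> 0%E].

(* Main.v *)
Require Import Defs.
From mathcomp Require Import all_boot all_order all_algebra.
From mathcomp Require Import all_classical all_reals all_analysis.
From mathcomp Require Import measurable_realfun ring lra.

(** The equation is an ordinary differential equation in time whose right-hand
side gains a derivative in space.  Write [G = u + u^2/2].  The velocity
[w = - d/dx (1 - d^2/dx^2)^-1 G] is minus the convolution of [G] with the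
derivative of [exp(-|x|)/2], and [u t = u 0 + \int_0^t w].  The singularities of
[u t] are therefore those of [u 0], plus those of a time integral that is one
derivative smoother than [u] itself.

Three facts make this precise.

- The convolutions with [exp(-|x|)/2] and with its derivative are locally
  uniformly continuous in the flux measured in the weighted space
  [L^1(exp(-|x|) dx)], and the flux in that space depends continuously on [u] in
  [L^2].  As [u] is differentiable in time with values in [L^2], it is continuous
  there, so the velocity and [(1 - d^2/dx^2)^-1 G] are jointly continuous in
  [(t, x)] ([jcont_kernel]).

- [u t = u 0 + \int_0^t w] holds almost everywhere ([L2_integral_eq]): cut off to
  a bounded interval, the difference of the two sides is a curve in [L^2] whose
  derivative vanishes, hence its norm is a real function with zero derivative.

- If [G] agrees almost everywhere on an open set with a continuous function, then
  the velocity is differentiable there and its derivative is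
  [G - (1 - d^2/dx^2)^-1 G] ([is_derive_dhelmholtz_inv]); moreover the second
  term has derivative [- w] everywhere ([is_derive_helmholtz_inv]).

Bootstrapping ([CtC_velocity]): if on the open set [w] is [C^m] in space, with
derivatives jointly continuous in time and space, and [m <= k], then so are its
time integral, [u] (because [u 0] is [C^k]), [G] and [(1 - d^2/dx^2)^-1 G], hence
[w] is [C^(m+1)].  The induction ends with [w] and its time integral in
[C([0, T] : C^(k+1))].  On compact sets [C^(k+1)] embeds in [C^(k+theta)]
([holder_quotient_le]), and the initial datum, which is merely
[C^(k+theta)], cancels in the differences [u t - u t0]; this gives all the claims
about [u], and those about its time derivative because the latter is [w].

Both convolutions are handled by one device.  For a fixed [y], the functions
[z |-> exp(-|z - y|)/2] and its derivative solve [f'' = f] away from [y].  Their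
values at [z] are thus combinations of their values at [x] with coefficients
[cosh(z - x)] and [sinh(z - x)], up to a correction carried by the [y] between
[x] and [z] ([green_expand], [dgreen_expand]).  After integration against [G] the
main part is an explicit smooth function of [z], and continuity and
differentiability at [x] only depend on the integral of [G] over the short
interval between [x] and [z]. *)

Set Implicit Arguments.
Unset Strict Implicit.
Unset Printing Implicit Defensive.

Import Order.TTheory GRing.Theory Num.Theory.
Import numFieldNormedType.Exports.

Local Open Scope classical_set_scope.
Local Open Scope ring_scope.

(** * Derivatives as linear error estimates *)

(** Estimates of integrals come as bounds on the error of the linear
approximation, with no division by the increment. *)
Lemma is_derive_eps (R : realType) (f : R -> R) (x d : R) :
  (forall e, 0 < e ->
     \forall z \near x, `|f z - f x - (z - x) * d| <= e * `|z - x|) <->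
  is_derive x 1 f d.
Proof.
have key (h r c : R) : h != 0 -> h^-1 * (r - h * c) = h^-1 * r - c.
  by move=> h0; rewrite mulrBr mulKf.
split=> [fd|[df <-] e e0].
- have h : h^-1 *: (f (h *: 1 + x) - f x) @[h --> 0^'] --> d.
    apply/cvgrPdist_le => e e0.
    have /nbhs_ballP[r /= r0 fr] := fd e e0.
    exists r => //= h /=; rewrite sub0r normrN => hr h0.
    have := fr (h + x); rewrite /ball/= opprD addrCA subrr addr0 normrN addrK.
    move=> /(_ hr) {}fr.
    rewrite distrC [h *: 1]mulr1 -[_ *: _]/(_ * _).
    suff: `|h^-1 * (f (h + x) - f x) - d| <= e by [].
    rewrite -key// normrM normfV.
    by rewrite mulrC ler_pdivrMr ?normr_gt0.
  apply: DeriveDef; first by apply/cvg_ex; exists d.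
  exact/cvg_lim.
- have : h^-1 *: (f (h *: 1 + x) - f x) @[h --> 0^'] --> 'D_1 f x by exact: df.
  move=> /cvgrPdist_le/(_ _ e0)/nbhs_ballP[r /= r0 fr].
  apply/nbhs_ballP; exists r => //= z; rewrite /ball/= => xz.
  have [->|zx] := eqVneq z x; first by rewrite !subrr mul0r subrr normr0 mulr0.
  have := fr (z - x); rewrite /ball/= sub0r normrN distrC => /(_ xz).
  rewrite subr_eq0 => /(_ zx).
  rewrite [_ *: 1]mulr1 subrK -[_ *: _]/(_ * _) [X in X <= _ -> _]distrC.
  rewrite -[X in `|X| <= _ -> _]/((z - x)^-1 * (f z - f x) - 'D_1 f x).
  rewrite -key// ?subr_eq0//.
  rewrite normrM normfV [X in X <= _ -> _]mulrC.
  by rewrite ler_pdivrMr ?normr_gt0 ?subr_eq0// (distrC x).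
Qed.

Lemma is_derive_continuous (R : realType) (f : R -> R) (x d : R) :
  is_derive x 1 f d -> {for x, continuous f}.
Proof.
by case=> df _; apply: differentiable_continuous; apply/derivable1_diffP.
Qed.

Lemma mvt_bound (R : realType) (f df : R -> R) (a b C : R) :
  (forall x, Num.min a b <= x <= Num.max a b -> is_derive x 1 f (df x)) ->
  (forall x, Num.min a b <= x <= Num.max a b -> `|df x| <= C) ->
  `|f b - f a| <= C * `|b - a|.
Proof.
wlog ab : a b / a <= b.
  move=> wl; case: (leP a b) => [/[dup] ab /wl|/ltW/[dup] ab /wl].
    by rewrite min_l ?max_r.
  by rewrite min_l// max_r// (distrC (f b)) (distrC b).
rewrite min_l// max_r// => fd fC.
have [|x|c cab ->] := @MVT_segment R f df a b ab.
- by move=> x /itvP xab; apply: fd; rewrite !xab.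
- apply: continuous_in_subspaceT => y; rewrite inE/= in_itv/= => yab.
  exact: is_derive_continuous (fd _ yab).
- by rewrite normrM ler_wpM2r//; apply: fC; rewrite !(itvP cab).
Qed.

(** * Antiderivatives on the whole line *)

(** The lower limit is to the left of both [0] and [t], so that one formula
serves for the two signs of [t]. *)
Definition primitive (R : realType) (h : R -> R) (t : R) : R :=
  \int[@lebesgue_measure R]_(x in `[- (`|t| + 1), t]) h x -
  \int[@lebesgue_measure R]_(x in `[- (`|t| + 1), 0]) h x.

Section primitive.
Variables (R : realType) (h : R -> R).
Hypothesis ch : continuous h.
Local Notation mu := (@lebesgue_measure R).

Let ih (a b : R) : mu.-integrable `[a, b] (EFin \o h).
Proof.
apply: continuous_compact_integrable; first exact: segment_compact.
exact: continuous_subspaceT.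
Qed.

Let split_int (a b x : R) : a <= b -> b <= x ->
  \int[mu]_(y in `[a, x]) h y =
  \int[mu]_(y in `[a, b]) h y + \int[mu]_(y in `[b, x]) h y.
Proof.
move=> ab bx.
have := @Rintegral_itvB R h (BLeft a) (BRight x) b (ih _ _) ab bx.
rewrite Rintegral_itv_obnd_cbnd => [/eqP|]; first by rewrite subr_eq addrC => /eqP.
apply: integrableS (ih b x) => //; apply: subset_itvr; by rewrite bnd_simp.
Qed.

(** The lower limit in the definition moves with [t]; by additivity of the
integral any fixed one will do locally, which is the form to which the
fundamental theorem of calculus applies. *)
Lemma primitiveE (a t : R) : a <= t -> a <= 0 ->
  primitive h t = \int[mu]_(x in `[a, t]) h x - \int[mu]_(x in `[a, 0]) h x.
Proof.
move=> at_ a0; rewrite /primitive; set c := - (`|t| + 1).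
have ct : c <= t by rewrite /c; have := ler_norm (- t); rewrite normrN; lra.
have c0 : c <= 0 by rewrite /c; have := normr_ge0 t; lra.
have key (b d : R) : b <= d -> d <= t -> d <= 0 ->
    \int[mu]_(x in `[b, t]) h x - \int[mu]_(x in `[b, 0]) h x =
    \int[mu]_(x in `[d, t]) h x - \int[mu]_(x in `[d, 0]) h x.
  move=> bd dt d0; rewrite (split_int bd dt) (split_int bd d0); lra.
by case: (leP a c) => [ac|/ltW ca]; [rewrite (key a c)|rewrite (key c a)].
Qed.

Lemma primitive0 : primitive h 0 = 0.
Proof. by rewrite /primitive subrr. Qed.

Lemma is_derive_primitive (t : R) : is_derive t 1 (primitive h) (h t).
Proof.
(* The margin 2 keeps [a] to the left of every point near [t]. *)
pose a : R := - (`|t| + 2).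
have at_ : a < t by rewrite /a; have := ler_norm (- t); rewrite normrN; lra.
have a0 : a < 0 by rewrite /a; have := normr_ge0 t; lra.
have tt1 : t < t + 1 by rewrite ltrDl.
have [dF F't] := continuous_FTC1_closed tt1 (ih a _) at_ (@ch t).
apply: (@near_eq_is_derive _ _ _ (fun t =>
    \int[mu]_(x in `[a, t]) h x - \int[mu]_(x in `[a, 0]) h x)).
  near=> z; rewrite (@primitiveE a)//; last exact: ltW.
  by apply: ltW; near: z; exact: lt_nbhsr.
rewrite -[X in is_derive _ _ _ X]subr0; apply: is_deriveB.
by apply: DeriveDef => //; rewrite -derive1E.
Unshelve. all: by end_near. Qed.

End primitive.

(** * Jointly continuous functions of time and space *)
Lemma between_norm (R : realType) (a b s : R) :
  Num.min a b <= s <= Num.max a b -> `|s - a| <= `|b - a|.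
Proof.
case: (leP a b) => [ab|ba] /andP[s1 s2].
  by rewrite !ger0_norm; lra.
by rewrite !ler0_norm; lra.
Qed.

Lemma is_derive_mulr (R : realType) (c x : R) : is_derive x 1 (fun y => y * c) c.
Proof.
apply/is_derive_eps => e e0; apply/nbhs_ballP; exists 1 => //= z _.
by rewrite -mulrBl subrr normr0 mulr_ge0// ltW.
Qed.

(** Curves of functions are defined for all times; those living on [[0, T]] are
extended by constants further down. *)
Definition jcont (R : realType) (O : set R) (f : R -> R -> R) :=
  forall t x, O x -> {for (t, x), continuous (fun p : R * R => f p.1 p.2)}.

Lemma jcontP (R : realType) (O : set R) (f : R -> R -> R) :
  jcont O f <-> forall t x, O x -> forall e, 0 < e -> exists2 d, 0 < d &
    forall t' x', `|t' - t| < d -> `|x' - x| < d -> `|f t' x' - f t x| < e.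
Proof.
split=> [jf t x Ox e e0|jf t x Ox].
  have /cvgrPdist_lt/(_ e e0)/nbhs_ballP[d d0 df] := jf t x Ox.
  exists d => // t' x' tt' xx'; rewrite distrC; apply: (df (t', x')).
  by split; rewrite /ball/= distrC.
apply/cvgrPdist_lt => e e0; have [d d0 df] := jf t x Ox e e0.
exists (ball t d, ball x d); first by split; exact: nbhsx_ballx.
move=> -[t' x'] [/=]; rewrite /ball/= => tt' xx'.
by rewrite distrC; apply: df; rewrite distrC.
Qed.

Section jcont.
Variables (R : realType) (O : set R).
Implicit Types f g : R -> R -> R.

Lemma jcontD f g : jcont O f -> jcont O g -> jcont O (fun t x => f t x + g t x).
Proof. by move=> jf jg t x Ox; apply: cvgD; [exact: jf|exact: jg]. Qed.

Lemma jcontM f g : jcont O f -> jcont O g -> jcont O (fun t x => f t x * g t x).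
Proof. by move=> jf jg t x Ox; apply: cvgM; [exact: jf|exact: jg]. Qed.

Lemma jcont_cst (h : R -> R) : (forall x, O x -> {for x, continuous h}) ->
  jcont O (fun=> h).
Proof.
move=> ch t x Ox; apply: (@continuous_comp _ _ _ (fun p : R * R => p.2) h).
  exact: cvg_snd.
exact: ch.
Qed.

Lemma jcont_time f x : jcont O f -> O x -> continuous (f^~ x).
Proof.
move=> jf Ox t.
apply: (@continuous_comp _ _ _ (fun t => (t, x)) (fun p : R * R => f p.1 p.2)).
  by apply: (@cvg_pair _ _ _ _ (nbhs t) (nbhs x)); [exact: cvg_id|exact: cvg_cst].
exact: jf.
Qed.

Lemma jcont_space f t x : jcont O f -> O x -> {for x, continuous (f t)}.
Proof.
move=> jf Ox.
apply: (@continuous_comp _ _ _ (fun x => (t, x)) (fun p : R * R => f p.1 p.2)).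
  by apply: (@cvg_pair _ _ _ _ (nbhs t) (nbhs x)); [exact: cvg_cst|exact: cvg_id].
exact: jf.
Qed.

(** Joint continuity at the points of [{t0} x K] is uniform along the compact
[K]; this is what turns it into continuity for the seminorms on compact sets. *)
Lemma jcont_unif_time f K t0 e : jcont O f -> compact K -> K `<=` O -> 0 < e ->
  \forall t \near t0, forall x, K x -> `|f t x - f t0 x| < e.
Proof.
move=> /jcontP jf /compact_near_coveringP cK KO e0.
apply: (cK R (nbhs t0) (fun t x => `|f t x - f t0 x| < e) _) => x Kx.
have e20 : 0 < e / 2 by rewrite divr_gt0.
have [d d0 df] := jf t0 x (KO _ Kx) _ e20.
exists (ball x d, ball t0 d); first by split; exact: nbhsx_ballx.
move=> [x' t] [/=]; rewrite /ball/= distrC => xx' /[1!distrC] tt0.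
rewrite [ltRHS]splitr (le_lt_trans (ler_distD (f t0 x) _ _))// ltrD//.
  exact: df.
by rewrite distrC; apply: df => //; rewrite subrr normr0.
Qed.

(** The same with a compact interval of times, as needed to integrate in time. *)
Lemma jcont_unif_space f a b x0 e : jcont O f -> O x0 -> 0 < e ->
  \forall x \near x0, forall t, a <= t <= b -> `|f t x - f t x0| < e.
Proof.
move=> /jcontP jf Ox0 e0.
have /compact_near_coveringP cK := @segment_compact R a b.
suff: \forall x \near x0, [set` `[a, b]] `<=` (fun t => `|f t x - f t x0| < e).
  by apply: filterS => x h t tab; apply: h; rewrite /= in_itv.
apply: (cK R (nbhs x0) (fun x t => `|f t x - f t x0| < e) _) => t tab.
have e20 : 0 < e / 2 by rewrite divr_gt0.
have [d d0 df] := jf t x0 Ox0 _ e20.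
exists (ball t d, ball x0 d); first by split; exact: nbhsx_ballx.
move=> [t' x] [/=]; rewrite /ball/= distrC => tt' /[1!distrC] xx0.
rewrite [ltRHS]splitr (le_lt_trans (ler_distD (f t x0) _ _))// ltrD//.
  exact: df.
by rewrite distrC; apply: df => //; rewrite subrr normr0.
Qed.

Lemma primitive_bound (h : R -> R) (t C : R) : continuous h ->
  (forall s, Num.min 0 t <= s <= Num.max 0 t -> `|h s| <= C) ->
  `|primitive h t| <= C * `|t|.
Proof.
move=> ch hC; have := @mvt_bound R (primitive h) h 0 t C _ hC.
by rewrite primitive0 !subr0; apply=> s _; exact: is_derive_primitive.
Qed.

(** Antiderivatives vanishing at [0] are unique, so that linearity follows
without returning to the integrals. *)
Lemma primitiveB (g h : R -> R) (t : R) : continuous g -> continuous h ->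
  primitive (g \- h) t = primitive g t - primitive h t.
Proof.
move=> cg ch.
have dgh (s : R) :
    is_derive s (1 : R) (primitive (g \- h) \- (primitive g \- primitive h)) 0.
  have cgh : continuous (g \- h) by move=> z; apply: cvgB; [exact: cg|exact: ch].
  rewrite -(subrr (g s - h s)).
  by apply: is_deriveB; [|apply: is_deriveB]; exact: is_derive_primitive.
have := is_derive_0_is_cst t 0 dgh; rewrite /= !primitive0 subrr subr0 => /eqP.
by rewrite subr_eq0 => /eqP.
Qed.

Lemma primitiveZ (c : R) (h : R -> R) (t : R) : continuous h ->
  primitive (fun s => c * h s) t = c * primitive h t.
Proof.
move=> ch.
have dh (s : R) :
    is_derive s (1 : R) (primitive (fun s => c * h s) \- c \*: primitive h) 0.
  have cch : continuous (fun s => c * h s) by move=> z; apply: cvgMr; exact: ch.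
  rewrite -(subrr (c * h s)).
  apply: is_deriveB; first exact: is_derive_primitive.
  by apply: is_deriveZ; exact: is_derive_primitive.
have := is_derive_0_is_cst t 0 dh; rewrite /= !primitive0 scaler0 subrr => /eqP.
by rewrite subr_eq0 => /eqP.
Qed.

(** The increment splits into a time increment, controlled by a bound on [f] near
[(t, x)], and the integral over [[0, t]] of a difference in space, which is
small uniformly in time. *)
Lemma jcont_primitive f : open O -> jcont O f ->
  jcont O (fun t x => primitive (f^~ x) t).
Proof.
move=> oO jf; apply/jcontP => t x Ox e e0.
have /jcontP/(_ t x Ox 1 ltr01)[d d0 df] := jf.
pose C := `|f t x| + 1.
have C0 : 0 < C by rewrite ltr_wpDl.
have t0 : 0 < `|t| + 1 by rewrite ltr_wpDl.
have e1 : 0 < e / 2 / (`|t| + 1) by rewrite !divr_gt0.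
have /nbhs_ballP[p p0 hO] : \forall z \near x, O z by exact: open_nbhs_nbhs.
have /nbhs_ballP[r r0 hr] := jcont_unif_space (Num.min 0 t) (Num.max 0 t) jf Ox e1.
have e2 : 0 < e / 2 / C by rewrite !divr_gt0.
exists (Num.min (Num.min d r) (Num.min p (e / 2 / C))).
  by rewrite !lt_min d0 r0 p0 e2.
move=> t' x'; rewrite !lt_min => /andP[/andP[t'd _] /andP[_ t'e]].
move=> /andP[/andP[x'd x'r] /andP[x'p _]].
have Ox' : O x' by apply: (hO x'); rewrite /ball/= distrC.
have cx' : continuous (f^~ x') by exact: jcont_time.
have cx : continuous (f^~ x) by exact: jcont_time.
rewrite [ltRHS]splitr (le_lt_trans (ler_distD (primitive (f^~ x') t) _ _))// ltr_leD//.
  apply: (@le_lt_trans _ _ (C * `|t' - t|)).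
    apply: (@mvt_bound _ _ (f^~ x')) => s /between_norm st.
      exact: is_derive_primitive.
    have := df s x' (le_lt_trans st t'd) x'd.
    by rewrite /C; have := ler_normD (f s x' - f t x) (f t x); rewrite subrK; lra.
  by rewrite mulrC -ltr_pdivlMr.
rewrite -primitiveB//.
apply: le_trans (@primitive_bound _ t (e / 2 / (`|t| + 1)) _ _) _.
- by move=> s; apply: cvgB; [exact: cx'|exact: cx].
- by move=> s ts; apply: ltW; apply: hr => //; rewrite /ball/= distrC.
- by rewrite mulrAC ler_pdivrMr// ler_wpM2l//; lra.
Qed.

(** Differentiation under the integral sign.  The error of the linear
approximation of [f s] at [x] is at most [e1 * |z - x|] uniformly in the time
[s], by the mean value theorem and the uniform continuity of [f'] in time, and
integrating this bound over [[0, t]] costs a factor [|t|]. *)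
Lemma is_derive_primitive_space f f' : open O -> jcont O f -> jcont O f' ->
  (forall t x, O x -> is_derive x 1 (f t) (f' t x)) ->
  forall t x, O x ->
    is_derive x 1 (fun x => primitive (f^~ x) t) (primitive (f'^~ x) t).
Proof.
move=> oO jf jf' ff' t x Ox; apply/is_derive_eps => e e0.
pose e1 := e / (`|t| + 1).
have t1 : 0 < `|t| + 1 by rewrite ltr_wpDl.
have e10 : 0 < e1 by rewrite divr_gt0.
have h1 := jcont_unif_space (Num.min 0 t) (Num.max 0 t) jf' Ox e10.
have h2 : \forall z \near x, O z by exact: open_nbhs_nbhs.
have /nbhs_ballP[r r0 rx] : \forall z \near x, (forall s,
  Num.min 0 t <= s <= Num.max 0 t -> `|f' s z - f' s x| < e1) /\ O z.
  exact: filterI h1 h2.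
apply/nbhs_ballP; exists r => // z xz.
have [_ Oz] := rx _ xz.
have cz : continuous (f^~ z) by exact: jcont_time.
have cx : continuous (f^~ x) by exact: jcont_time.
have c'x : continuous (f'^~ x) by exact: jcont_time.
have c''x : continuous (fun s => (z - x) * f' s x).
  by move=> s; apply: cvgMr; exact: c'x.
have czx : continuous (f^~ z \- f^~ x).
  by move=> s; apply: cvgB; [exact: cz|exact: cx].
rewrite -primitiveB// -primitiveZ// -primitiveB//.
apply: (@le_trans _ _ ((e1 * `|z - x|) * `|t|)).
  apply: primitive_bound => [s|s ts]; first by apply: cvgB; [exact: czx|exact: c''x].
  have := @mvt_bound R (fun y => f s y - y * f' s x)
    (fun y => f' s y - f' s x) x z e1 _ _.
  rewrite (_ : f s z - z * f' s x - (f s x - x * f' s x) =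
     f s z - f s x - (z - x) * f' s x); last by ring.
  have sub y : Num.min x z <= y <= Num.max x z -> ball x r y.
    move=> /between_norm xy; rewrite /ball/= distrC (le_lt_trans xy)//.
    by rewrite distrC.
  apply=> y /sub/rx[y1 y2]; last by apply: ltW; apply: y1.
  by apply: is_deriveB; [exact: ff'|exact: is_derive_mulr].
rewrite mulrAC ler_wpM2r// /e1 mulrAC ler_pdivrMr// ler_wpM2l//; [exact: ltW|lra].
Qed.

End jcont.

(** * Continuous curves of m times differentiable functions *)

(** The space derivatives are given by some tower of functions instead of by
iterated [derive1]: sums, products and time integrals of towers are towers by
structural induction, and [CtC_derive1n] makes the link with [derive1]. *)
Fixpoint CtC (R : realType) (O : set R) (m : nat) (f : R -> R -> R) : Prop :=
  jcont O f /\
  if m is n.+1 then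
    exists2 f' : R -> R -> R,
      forall t x, O x -> is_derive x 1 (f t) (f' t x) & CtC O n f'
  else True.

Section CtC.
Variables (R : realType) (O : set R).
Hypothesis oO : open O.
Implicit Types f g : R -> R -> R.

Lemma CtC_jcont m f : CtC O m f -> jcont O f.
Proof. by case: m => [|m] []. Qed.

Lemma CtCW m f : CtC O m.+1 f -> CtC O m f.
Proof.
elim: m f => [|m ih] f [jf [f' df Cf']]; first by split.
by split=> //; exists f' => //; exact: ih.
Qed.

Lemma CtCD m f g : CtC O m f -> CtC O m g -> CtC O m (fun t x => f t x + g t x).
Proof.
elim: m f g => [|m ih] f g [jf Cf] [jg Cg]; split=> //; try exact: jcontD.
have [f' df Cf'] := Cf; have [g' dg Cg'] := Cg.
exists (fun t x => f' t x + g' t x); last exact: ih.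
by move=> t x Ox; apply: is_deriveD; [exact: df|exact: dg].
Qed.

Lemma CtCM m f g : CtC O m f -> CtC O m g -> CtC O m (fun t x => f t x * g t x).
Proof.
elim: m f g => [|m ih] f g Cf Cg.
  by split=> //; apply: jcontM; [case: Cf|case: Cg].
have Wf := CtCW Cf; have Wg := CtCW Cg.
move: Cf Cg => [jf [f' df Cf']] [jg [g' dg Cg']].
split; first exact: jcontM.
exists (fun t x => f t x * g' t x + g t x * f' t x).
  by move=> t x Ox; apply: is_deriveM; [exact: df|exact: dg].
by apply: CtCD; exact: ih.
Qed.

Lemma CtC_cst m (c : R) : CtC O m (fun _ _ => c).
Proof.
elim: m c => [|m ih] c; split=> //; try by apply: jcont_cst => x _; exact: cvg_cst.
by exists (fun _ _ => 0) => // t x Ox; exact: is_derive_cst.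
Qed.

Lemma CtC_freeze m f t0 : CtC O m f -> CtC O m (fun=> f t0).
Proof.
elim: m f => [|m ih] f [jf Cf]; split=> //;
  try by apply: jcont_cst => x Ox; exact: jcont_space Ox.
have [f' df Cf'] := Cf; exists (fun=> f' t0); last exact: ih.
by move=> _ x Ox; exact: df.
Qed.

Lemma CtCZ m c f : CtC O m f -> CtC O m (fun t x => c * f t x).
Proof. by move=> Cf; apply: CtCM => //; exact: CtC_cst. Qed.

Lemma CtC_primitive m f : CtC O m f -> CtC O m (fun t x => primitive (f^~ x) t).
Proof.
elim: m f => [|m ih] f [jf Cf]; split=> //; try exact: jcont_primitive.
have [f' df Cf'] := Cf.
exists (fun t x => primitive (f'^~ x) t); last exact: ih.
by move=> t x Ox; apply: (is_derive_primitive_space oO jf (CtC_jcont Cf') df).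
Qed.

Lemma CtC_Cktheta k theta m (g : R -> R) : Cktheta k theta O g -> (m <= k)%N ->
  CtC O m (fun=> g).
Proof.
move=> [dg cg _].
suff h n j : (n + j <= k)%N -> CtC O n (fun=> derive1n j g).
  by move=> mk; apply: (h m 0%N); rewrite addn0.
elim: n j => [|n ih] j njk.
  split=> //; apply: jcont_cst => x Ox.
  have [jk|kj] := ltnP j k; last first.
    have -> : j = k by apply/eqP; rewrite eqn_leq njk kj.
    exact: cg.
  by apply: differentiable_continuous; apply/derivable1_diffP; exact: dg.
have jk : (j < k)%N by apply: leq_trans njk; rewrite addSn ltnS leq_addl.
split.
  apply: jcont_cst => x Ox.
  by apply: differentiable_continuous; apply/derivable1_diffP; exact: dg.
exists (fun=> derive1n j.+1 g); last by apply: ih; rewrite addnS.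
move=> _ x Ox; apply: DeriveDef; first exact: dg.
by rewrite -derive1E.
Qed.

(** Derivatives are local and [O] is open. *)
Lemma derive1n_eq_on j (f g : R -> R) : (forall x, O x -> f x = g x) ->
  forall x, O x -> derive1n j f x = derive1n j g x.
Proof.
move=> fg; elim: j => // j ih x Ox.
rewrite !derive1nS !derive1E.
apply: near_eq_derive; have : \forall z \near x, O z by exact: open_nbhs_nbhs.
exact: filterS ih.
Qed.

Lemma CtC_derive1n m f : CtC O m f -> exists F : nat -> R -> R -> R,
  [/\ forall j t x, (j <= m)%N -> O x -> derive1n j (f t) x = F j t x,
      forall j, (j <= m)%N -> jcont O (F j) &
      forall j t x, (j < m)%N -> O x -> is_derive x 1 (F j t) (F j.+1 t x)].
Proof.
elim: m f => [|m ih] f; first by case=> jf _; exists (fun=> f); split=> // -[].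
case=> jf [f' df /ih [F [F1 F2 F3]]].
exists (fun j => if j is i.+1 then F i else f); split.
- move=> [//|j] t x jm Ox; rewrite /derive1n iterSr -/(derive1n j _) -F1//.
  apply: derive1n_eq_on => // y Oy; rewrite derive1E.
  by have [_ ->] := df t y Oy.
- by move=> [//|j] jm; exact: F2.
- move=> [|j] t x jm Ox; last exact: F3.
  by rewrite -F1//; exact: df.
Qed.

End CtC.

(** * Hoelder quotients on compact sets *)
Section holder.
Variables (R : realType) (O : set R).
Hypothesis oO : open O.

(** The mean value theorem between two near points of [K] needs the segment
joining them, which may leave [K]; it remains in a slightly larger compact. *)
Lemma compact_thicken K : compact K -> K `<=` O ->
  exists r, exists K', [/\ 0 < r, r <= 1, compact K', K' `<=` O &
    forall x y, K x -> `|y - x| <= r -> K' y].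
Proof.
move=> cK KO; have /compact_near_coveringP nK := cK.
have : \forall r \near 0^'+, K `<=` (fun x => forall y, `|y - x| <= r -> O y).
  apply: (nK R 0^'+ (fun r x => forall y, `|y - x| <= r -> O y) _) => x Kx.
  have /nbhs_ballP[p p0 hp] : \forall z \near x, O z.
    by apply: open_nbhs_nbhs; split=> //; exact: KO.
  exists (ball x (p / 2), [set r | r < p / 2]).
    split; first by apply: nbhsx_ballx; rewrite divr_gt0.
    by apply: nbhs_right_lt; rewrite divr_gt0.
  move=> [x' r] [/=]; rewrite /ball/= => xx' rp y yx'; apply: hp.
  rewrite /ball/= [ltRHS]splitr (le_lt_trans (ler_distD x' _ _))// ltrD//.
  by rewrite distrC (le_lt_trans yx').
move=> hr.
have [r [r0 r1 rK]] : exists r, [/\ 0 < r, r <= 1 &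
    K `<=` (fun x => forall y, `|y - x| <= r -> O y)].
  near (0:R)^'+ => r; exists r; split=> //; last by near: r.
  by near: r; exact: nbhs_right_le.
exists r, ((fun p : R * R => p.1 + p.2) @` (K `*` `[- r, r])); split=> //.
- apply: continuous_compact; last first.
    by apply: compact_setX => //; exact: segment_compact.
  have cadd : continuous (fun p : R * R => p.1 + p.2).
    by move=> p; apply: cvgD; [exact: cvg_fst|exact: cvg_snd].
  exact (continuous_subspaceT cadd).
- move=> y [[x h] [/= Kx + yE]]; rewrite in_itv/= => hr'.
  rewrite -yE; apply: (rK x) => //.
  by rewrite addrC addKr ler_norml.
- move=> x y Kx yx; exists (x, y - x) => /=; last by rewrite addrC subrK.
  by split=> //=; rewrite in_itv/= -ler_norml.
Unshelve. all: by end_near. Qed.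

(** Points at distance at most [r] are compared by the mean value theorem, the
others by twice the supremum.  The bound depends linearly on [a] and [b], so that
it gives both finiteness and convergence to [0] of the seminorm. *)
Lemma holder_quotient_le (K K' : set R) (r theta a b : R) (f f' : R -> R) :
  0 < r -> r <= 1 -> 0 <= theta <= 1 -> 0 <= a -> 0 <= b ->
  (forall x y, K x -> `|y - x| <= r -> K' y) ->
  (forall x, K' x -> is_derive x 1 f (f' x)) ->
  (forall x, K x -> `|f x| <= a) -> (forall x, K' x -> `|f' x| <= b) ->
  forall x y, K x -> K y -> `|f x - f y| / `|x - y| `^ theta <= b + 2 * a / r.
Proof.
move=> r0 r1 /andP[th0 th1] a0 b0 KK' df fa fb x y Kx Ky.
have [->|xy] := eqVneq x y.
  by rewrite subrr normr0 mul0r addr_ge0// divr_ge0 ?(ltW r0)// mulr_ge0.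
have n0 : 0 < `|x - y| by rewrite normr_gt0 subr_eq0.
rewrite ler_pdivrMr ?powR_gt0//.
have [xyr|rxy] := leP `|x - y| r.
  apply: (@le_trans _ _ (b * `|x - y|)).
    apply: (@mvt_bound _ f f') => z /between_norm zy.
      by apply/df/(KK' y) => //; exact: le_trans zy _.
    by apply/fb/(KK' y) => //; exact: le_trans zy _.
  apply: ler_pM => //; first by rewrite lerDl divr_ge0 ?(ltW r0)// mulr_ge0.
  rewrite -[leLHS]powRr1// ?normr_ge0//.
  rewrite ger_powR// n0/=; exact: le_trans xyr r1.
apply: (@le_trans _ _ (2 * a)).
  rewrite (le_trans (ler_normB _ _))//.
  by have := fa x Kx; have := fa y Ky; lra.
rewrite [leRHS]mulrDl; apply: ler_wpDl; first by rewrite mulr_ge0 ?powR_ge0.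
rewrite -[leRHS]mulrA ler_peMr ?mulr_ge0//.
rewrite ler_pdivlMl// mulr1.
apply: (@le_trans _ _ (r `^ theta)).
  have r01 : 0 < r <= 1 by rewrite r0.
  by have := @ger_powR R r r01 theta 1 th1; rewrite powRr1 ?(ltW r0).
by rewrite ge0_ler_powR// ?nnegrE ?ltW.
Qed.

End holder.

(** * The C^(k+theta) topology *)
Lemma ecvg0 (R : realType) (I : Type) (F : set_system I) (FF : Filter F)
  (N : I -> \bar R) :
  (forall e : R, 0 < e -> \forall i \near F, (0 <= N i <= e%:E)%E) ->
  N i @[i --> F] --> 0%E.
Proof.
move=> h; apply/fine_cvgP; split.
  apply: filterS (h 1 ltr01) => i /andP[i0 i1].
  by rewrite ge0_fin_numE// (le_lt_trans i1)// ltry.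
apply/cvgrPdist_le => e e0.
apply: filterS (h e e0) => i /andP[i0 i1] /=.
rewrite sub0r normrN ger0_norm ?fine_ge0// -lee_fin fineK//.
by rewrite ge0_fin_numE// (le_lt_trans i1)// ltry.
Qed.

Section Cktheta_curve.
Variables (R : realType) (O : set R).
Hypothesis oO : open O.

Lemma compact_bounded_fun (K : set R) (f : R -> R) : compact K ->
  (forall x, K x -> {for x, continuous f}) ->
  exists2 C, 0 <= C & forall x, K x -> `|f x| <= C.
Proof.
move=> cK cf.
have cfK : compact (f @` K).
  apply: continuous_compact => //; apply: continuous_in_subspaceT => x.
  by rewrite inE; exact: cf.
have [M [_ hM]] := compact_bounded cfK.
exists (`|M| + 1) => [|x Kx]; first by rewrite addr_ge0.
by apply: (hM (`|M| + 1)); [rewrite ltr_pwDr ?ler_norm|exists x].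
Qed.

Lemma CtC_Cktheta_val k theta f t : 0 <= theta <= 1 ->
  CtC O k.+1 f -> Cktheta k theta O (f t).
Proof.
move=> th /(CtC_derive1n oO)[F [F1 F2 F3]].
have dF j x : (j <= k)%N -> O x -> is_derive x 1 (derive1n j (f t)) (F j.+1 t x).
  move=> jk Ox; apply: (@near_eq_is_derive _ _ _ (F j t)); last exact: F3.
  have : \forall z \near x, O z by exact: open_nbhs_nbhs.
  by apply: filterS => z Oz; rewrite F1// ltnW.
split.
- by move=> j x jk Ox; have [] := dF j x (ltnW jk) Ox.
- move=> x Ox; exact: is_derive_continuous (dF k x (leqnn _) Ox).
- move=> th0 K cK KO.
  have [r [K' [r0 r1 cK' K'O KK']]] := compact_thicken oO cK KO.
  have [a a0 fa] : exists2 C, 0 <= C & forall x, K x -> `|derive1n k (f t) x| <= C.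
    apply: compact_bounded_fun => // x Kx.
    exact: is_derive_continuous (dF k x (leqnn _) (KO _ Kx)).
  have [b b0 fb] : exists2 C, 0 <= C & forall x, K' x -> `|F k.+1 t x| <= C.
    apply: compact_bounded_fun => // x Kx.
    by apply: jcont_space (K'O _ Kx); exact: F2.
  apply: (@le_lt_trans _ _ (b + 2 * a / r)%:E); last exact: ltry.
  apply: ge_ereal_sup => _ [x Kx [y Ky <-]]; rewrite lee_fin.
  apply: (holder_quotient_le r0 r1 th a0 b0 KK' _ fa fb Kx Ky) => z K'z.
  by apply: dF => //; exact: K'O.
Qed.

Lemma derive1n_cst0 j : derive1n j (fun _ : R => 0 : R) = fun=> 0.
Proof.
elim: j => // j ih; rewrite derive1nS ih; apply/funext => x.
exact: derive1_cst.
Qed.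

(** All derivatives up to order [k+1] are uniformly small on the thickened
compact when [t] is close to [t0]; the derivative of order [k+1] controls the
Hoelder seminorm. *)
Lemma CtC_Cktheta_cvg k theta K f t0 : 0 <= theta <= 1 ->
  CtC O k.+1 f -> f t0 = (fun=> 0) -> compact K -> K !=set0 -> K `<=` O ->
  Cktheta_norm k theta K (f t) @[t --> t0] --> 0%E.
Proof.
move=> th /(CtC_derive1n oO)[F [F1 F2 F3]] ft0 cK [x0 Kx0] KO.
have [r [K' [r0 r1 cK' K'O KK']]] := compact_thicken oO cK KO.
have Ft0 j x : (j <= k.+1)%N -> O x -> F j t0 x = 0.
  by move=> jk Ox; rewrite -F1// ft0 derive1n_cst0.
have dF j t x : (j <= k)%N -> O x -> is_derive x 1 (derive1n j (f t)) (F j.+1 t x).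
  move=> jk Ox; apply: (@near_eq_is_derive _ _ _ (F j t)); last exact: F3.
  have : \forall z \near x, O z by exact: open_nbhs_nbhs.
  by apply: filterS => z Oz; rewrite F1// ltnW.
apply: ecvg0 => e e0.
pose L := 1 + 2 / r.
have L0 : 0 <= L by rewrite addr_ge0// divr_ge0// ltW.
pose d := e / (k.+1%:R + L).
have kL0 : 0 < k.+1%:R + L by rewrite ltr_pwDl.
have d0 : 0 < d by rewrite divr_gt0.
have near_small j : (j <= k.+1)%N ->
    \forall t \near t0, forall x, K' x -> `|F j t x| < d.
  move=> jk; have := jcont_unif_time t0 (F2 _ jk) cK' K'O d0.
  apply: filterS => t h x K'x.
  by rewrite -[F j t x]subr0 -(Ft0 _ _ jk (K'O _ K'x)); exact: h.
have all_small : \forall t \near t0, forall j, (j <= k.+1)%N ->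
    forall x, K' x -> `|F j t x| < d.
  suff : forall n, (n <= k.+2)%N -> \forall t \near t0, forall j, (j < n)%N ->
    forall x, K' x -> `|F j t x| < d by move=> /(_ _ (leqnn _)).
  elim=> [|n ih] nk; first by apply: filterS (near_small _ (leq0n _)).
  apply: filterS2 (ih (ltnW nk)) (near_small n nk) => t h1 h2 j.
  by rewrite ltnS leq_eqVlt => /predU1P[->|/h1].
apply: filterS all_small => t small.
have KK x : K x -> K' x by move=> Kx; apply: (KK' x) => //; rewrite subrr normr0 ltW.
have smallK j x : (j <= k)%N -> K x -> `|derive1n j (f t) x| <= d.
  move=> jk Kx; rewrite F1 ?(leqW jk)//; last exact: KO.
  by apply/ltW/small; [exact: leqW|exact: KK].
have sup0 j : (0 <= sup_norm K (derive1n j (f t)))%E.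
  apply: (@le_trans _ _ `|derive1n j (f t) x0|%:E); first by rewrite lee_fin.
  by apply: ereal_sup_ubound; exists x0.
apply/andP; split.
  rewrite adde_ge0//; first by apply: sume_ge0 => j _.
  case: ifP => // _; apply: ereal_sup_ubound; exists x0 => //; exists x0 => //.
  by rewrite !subrr normr0 mul0r.
apply: (@le_trans _ _ (\sum_(j < k.+1) d%:E + (L * d)%:E)%E).
  apply: leeD.
    apply: lee_sum => j _; apply: ge_ereal_sup => _ [x Kx <-].
    by rewrite lee_fin smallK// -ltnS.
  case: ifP => [th0|_]; last by rewrite lee_fin mulr_ge0// ltW.
  apply: ge_ereal_sup => _ [x Kx [y Ky <-]]; rewrite lee_fin.
  rewrite (_ : L * d = d + 2 * d / r); last by rewrite /L mulrDl mul1r mulrAC.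
  apply: (holder_quotient_le r0 r1 th (ltW d0) (ltW d0) KK' _ _ _ Kx Ky).
  - by move=> z K'z; apply: (dF k) => //; exact: K'O.
  - by move=> z; exact: smallK.
  - by move=> z K'z; apply: ltW; exact: small.
rewrite sumEFin -EFinD lee_fin sumr_const card_ord -mulr_natl -mulrDl.
by rewrite mulrC /d divfK// gt_eqF.
Qed.

Lemma CktthetaD k theta (f g : R -> R) : Cktheta k theta O f ->
  Cktheta k theta O g -> Cktheta k theta O (fun x => f x + g x).
Proof.
move=> [df cf hf] [dg cg hg].
have fgj j x : (j <= k)%N -> O x ->
    derive1n j (fun x => f x + g x) x = derive1n j f x + derive1n j g x.
  elim: j x => // j ih x jk Ox.
  rewrite !derive1nS !derive1E -deriveD; [|exact: df|exact: dg].
  apply: near_eq_derive; have : \forall z \near x, O z by exact: open_nbhs_nbhs.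
  by apply: filterS => z Oz; rewrite ih// ltnW.
have nearO x : O x -> \forall z \near x, O z by move=> Ox; exact: open_nbhs_nbhs.
split.
- move=> j x jk Ox.
  apply: (@near_eq_derivable _ _ _ (derive1n j f \+ derive1n j g)).
    by apply: filterS (nearO x Ox) => z Oz; rewrite fgj// ltnW.
  by apply: derivableD; [exact: df|exact: dg].
- move=> x Ox; suff : derive1n k (fun x => f x + g x) z @[z --> x] -->
      derive1n k f x + derive1n k g x by rewrite -fgj.
  apply: cvg_trans; last exact: cvgD (cf x Ox) (cg x Ox).
  apply: near_eq_cvg; apply: filterS (nearO x Ox) => z Oz.
  by rewrite fgj.
- move=> th0 K cK KO.
  apply: (@le_lt_trans _ _ (holder_seminorm theta K (derive1n k f) +
    holder_seminorm theta K (derive1n k g))%E); last first.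
    by rewrite lte_add_pinfty ?hf ?hg.
  apply: ge_ereal_sup => _ [x Kx [y Ky <-]].
  apply: (@le_trans _ _ ((`|derive1n k f x - derive1n k f y| / `|x - y| `^ theta)%:E +
    (`|derive1n k g x - derive1n k g y| / `|x - y| `^ theta)%:E)%E); last first.
    by apply: leeD; apply: ereal_sup_ubound; exists x => //; exists y.
  rewrite -EFinD lee_fin -mulrDl ler_wpM2r ?invr_ge0 ?powR_ge0//.
  rewrite !fgj//; try exact: KO.
  by rewrite opprD addrACA ler_normD.
Qed.

End Cktheta_curve.

(** * The Green function of 1 - d^2/dx^2 and its expansion *)
Section hyperbolic.
Variable R : realType.
Implicit Types x y z : R.

Definition sinhR x := (expR x - expR (- x)) / 2.
Definition coshR x := (expR x + expR (- x)) / 2.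

Lemma sinhR0 : sinhR 0 = 0.
Proof. by rewrite /sinhR oppr0 subrr mul0r. Qed.

Lemma coshR0 : coshR 0 = 1.
Proof. by rewrite /coshR oppr0 expR0 -mulr2n -mulr_natl mulfV ?pnatr_eq0. Qed.

Let is_derive_expRN x : is_derive x 1 (fun z => expR (- z)) (- expR (- x)).
Proof.
by rewrite -mulrN1; apply: (@is_derive1_comp _ expR -%R).
Qed.

Lemma is_derive_sinhR x : is_derive x 1 sinhR (coshR x).
Proof.
rewrite (_ : sinhR = 2^-1 \*: (expR \- (fun z => expR (- z)))); last first.
  by apply/funext => z; rewrite /sinhR /= mulrC.
rewrite (_ : coshR x = 2^-1 *: (expR x - - expR (- x))).
  by apply: is_deriveZ; exact: is_deriveB.
by rewrite opprK /coshR mulrC.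
Qed.

Lemma is_derive_coshR x : is_derive x 1 coshR (sinhR x).
Proof.
rewrite (_ : coshR = 2^-1 \*: (expR \+ (fun z => expR (- z)))); last first.
  by apply/funext => z; rewrite /coshR /= mulrC.
rewrite (_ : sinhR x = 2^-1 *: (expR x + - expR (- x))).
  by apply: is_deriveZ; exact: is_deriveD.
by rewrite /sinhR mulrC.
Qed.

Lemma coshR_le x : `|coshR x| <= expR `|x|.
Proof.
rewrite /coshR ger0_norm ?divr_ge0 ?addr_ge0 ?expR_ge0//.
have h1 : expR x <= expR `|x| by rewrite ler_expR ler_norm.
have h2 : expR (- x) <= expR `|x| by rewrite ler_expR -normrN ler_norm.
lra.
Qed.

Lemma sinhR_le x : `|sinhR x| <= `|x| * expR `|x|.
Proof.
have := @mvt_bound R sinhR coshR 0 x (expR `|x|) _ _.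
rewrite sinhR0 !subr0 mulrC; apply => y.
  by move=> _; exact: is_derive_sinhR.
move=> /between_norm; rewrite !subr0 => yx.
by apply: le_trans (coshR_le y) _; rewrite ler_expR.
Qed.

Lemma continuous_sinhR : continuous sinhR.
Proof.
by move=> x; exact: is_derive_continuous (is_derive_sinhR x).
Qed.

Lemma continuous_coshR : continuous coshR.
Proof.
by move=> x; exact: is_derive_continuous (is_derive_coshR x).
Qed.

End hyperbolic.

Definition green (R : realType) (x y : R) : R := 2^-1 * expR (- `|x - y|).

(** The derivative of [green] in [x], with the value on the diagonal that makes
[dgreen_expand] exact at every point. *)
Definition dgreen (R : realType) (x y : R) : R :=
  (1 - 2 * (y <= x)%R%:R) * green x y.

(** The signed indicator function of the points between [x] and [z]: its integral
is [z - x], whatever the order of [x] and [z]. *)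
Definition crossing (R : realType) (x z y : R) : R :=
  (x < y <= z)%R%:R - (z < y <= x)%R%:R.

Section kernel_identities.
Variable R : realType.
Implicit Types x y z : R.

Lemma expR_distl x y : y <= x -> expR (- `|x - y|) = expR y / expR x.
Proof. by move=> yx; rewrite ger0_norm ?subr_ge0// opprB expRB. Qed.

Lemma expR_distr x y : x < y -> expR (- `|x - y|) = expR x / expR y.
Proof. by move=> xy; rewrite ltr0_norm ?subr_lt0// opprK expRB. Qed.

(** As a function of [z], [green z y] solves [f'' = f] except at [z = y], so that
it is determined by its value and slope at [x] as long as [z] has not crossed
[y]; the jump of the slope at [y] produces the last term. *)
Lemma green_expand x z y : green z y =
  coshR (z - x) * green x y + sinhR (z - x) * dgreen x y
  - crossing x z y * sinhR (z - y).
Proof.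
rewrite /green /dgreen /crossing /green /sinhR /coshR !opprB !expRB.
have ex := expR_gt0 x; have ey := expR_gt0 y; have ez := expR_gt0 z.
have [yx|xy] := leP y x; have [yz|zy] := leP y z; rewrite /=;
  [rewrite !expR_distl//|rewrite expR_distr// expR_distl//
  |rewrite expR_distl// expR_distr//|rewrite !expR_distr//];
  by field; rewrite !gt_eqF.
Qed.

Lemma dgreen_expand x z y : dgreen z y =
  sinhR (z - x) * green x y + coshR (z - x) * dgreen x y
  - crossing x z y * coshR (z - y).
Proof.
rewrite /green /dgreen /crossing /green /sinhR /coshR !opprB !expRB.
have ex := expR_gt0 x; have ey := expR_gt0 y; have ez := expR_gt0 z.
have [yx|xy] := leP y x; have [yz|zy] := leP y z; rewrite /=;
  [rewrite !expR_distl//|rewrite expR_distr// expR_distl//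
  |rewrite expR_distl// expR_distr//|rewrite !expR_distr//];
  by field; rewrite !gt_eqF.
Qed.

End kernel_identities.

(** * Integrals against exponentially decaying kernels *)
Section weighted.
Variable R : realType.
Local Notation mu := (@lebesgue_measure R).
Implicit Types (g k c : R -> R) (x y z C D e : R).

Definition exp_integrable g := measurable_fun setT g /\
  mu.-integrable setT (EFin \o (fun y => expR (- `|y|) * g y)).

(** The norm of [L^1(exp(-|y|) dy)].  This space contains [L^2] and the squares of
its elements, hence the flux of every [L^2] function. *)
Definition exp_norm g : R := \int[mu]_y (expR (- `|y|) * `|g y|).

Lemma measurable_weight : measurable_fun setT (fun y : R => expR (- `|y|)).
Proof.
apply: continuous_measurable_fun => y.
apply: (@continuous_comp _ _ _ (fun y : R => - `|y|) expR).
  by apply: cvgN; exact: norm_continuous.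
exact: continuous_expR.
Qed.

Lemma exp_integrable_norm g : exp_integrable g ->
  mu.-integrable setT (EFin \o (fun y => expR (- `|y|) * `|g y|)).
Proof.
move=> [mg ig]; apply: eq_integrable (integrable_norm ig) => // y _ /=.
by rewrite normrM ger0_norm ?expR_ge0.
Qed.

Lemma exp_integrable_mul k g C : measurable_fun setT k -> exp_integrable g ->
  (forall y, `|k y| <= C * expR (- `|y|)) ->
  mu.-integrable setT (EFin \o (fun y => k y * g y)).
Proof.
move=> mk [mg ig] kC.
have iCg : mu.-integrable setT (EFin \o (fun y => C * (expR (- `|y|) * g y))).
  by have := integrableZl measurableT C ig; exact: eq_integrable.
apply: le_integrable iCg => //.
  by apply/measurable_EFinP; exact: measurable_funM.
move=> y _ /=; rewrite lee_fin mulrA !normrM ler_wpM2r//.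
by rewrite -normrM (le_trans (kC y))// ler_norm.
Qed.

Lemma exp_integrable_mul_le k g C : measurable_fun setT k -> exp_integrable g ->
  (forall y, `|k y| <= C * expR (- `|y|)) ->
  `|\int[mu]_y (k y * g y)| <= C * exp_norm g.
Proof.
move=> mk wg kC; have ikg := exp_integrable_mul mk wg kC.
rewrite (le_trans (le_normr_Rintegral measurableT ikg))//.
have ing := exp_integrable_norm wg.
rewrite -RintegralZl//; apply: le_Rintegral => //.
- exact: integrable_norm ikg.
- by have := integrableZl measurableT C ing; exact: eq_integrable.
- by move=> y _; rewrite normrM mulrA ler_wpM2r.
Qed.

Lemma measurable_green x : measurable_fun setT (green x).
Proof.
apply: measurable_funM => //.
apply: continuous_measurable_fun => y.
apply: (@continuous_comp _ _ _ (fun y : R => - `|x - y|) expR).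
  apply: cvgN; apply: cvg_norm.
  by apply: cvgB; [exact: cvg_cst|exact: cvg_id].
exact: continuous_expR.
Qed.

Lemma measurable_dgreen x : measurable_fun setT (dgreen x).
Proof.
apply: measurable_funM; last exact: measurable_green.
rewrite (_ : (fun y => _) = (fun y => 1 - 2 * \1_`]-oo, x] y)).
  by apply: measurable_funB => //; apply: measurable_funM.
by apply/funext => y; rewrite indicE mem_setE in_itv.
Qed.

Lemma crossingE x z : crossing x z = (fun y => \1_`]x, z] y - \1_`]z, x] y).
Proof. by apply/funext => y; rewrite !indicE !mem_setE !in_itv. Qed.

Lemma measurable_crossing x z : measurable_fun setT (crossing x z).
Proof. by rewrite crossingE; apply: measurable_funB. Qed.

Lemma green_le x y : `|green x y| <= (2^-1 * expR `|x|) * expR (- `|y|).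
Proof.
rewrite /green ger0_norm ?mulr_ge0 ?expR_ge0// -mulrA ler_wpM2l//.
rewrite -expRD ler_expR.
have := ler_distD x 0 y; rewrite !sub0r !normrN; lra.
Qed.

Lemma dgreen_le x y : `|dgreen x y| <= (2^-1 * expR `|x|) * expR (- `|y|).
Proof.
apply: le_trans (green_le x y); rewrite /dgreen normrM ler_piMl//.
by case: (y <= x); rewrite ?mulr1 ?mulr0 ?subr0 ?normr1// ler_norml; lra.
Qed.

Lemma crossing_neq0 x z y : crossing x z y != 0 -> `|y - x| <= `|z - x|.
Proof.
rewrite /crossing; have [xy|yx] := ltP x y; have [yz|zy] := leP y z => //=.
- by rewrite !ger0_norm; lra.
- by rewrite subrr eqxx.
- by rewrite subrr eqxx.
- by rewrite !ler0_norm; lra.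
Qed.

Lemma norm_crossing_le1 x z y : `|crossing x z y| <= 1.
Proof.
by rewrite /crossing; have [xy|yx] := ltP x y; have [yz|zy] := leP y z;
  rewrite /= ?subrr ?subr0 ?sub0r ?normrN ?normr0 ?normr1.
Qed.

Lemma crossing_mul_le x z c D : 0 <= D ->
  (forall y, `|y - x| <= `|z - x| -> `|c y| <= D) ->
  forall y, `|crossing x z y * c y| <= D * expR (2 * `|x| + `|z|) * expR (- `|y|).
Proof.
move=> D0 cD y; rewrite -mulrA -expRD.
have [->|s0] := eqVneq (crossing x z y) 0.
  by rewrite mul0r normr0 mulr_ge0 ?expR_ge0.
have yx := crossing_neq0 s0; rewrite normrM.
apply: (@le_trans _ _ (1 * D)); first by rewrite ler_pM ?norm_crossing_le1 ?cD.
rewrite mul1r ler_peMr// -{1}(@expR0 R) ler_expR.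
have := ler_normB z x; have := ler_normD (y - x) x; rewrite subrK. lra.
Qed.

(** The correction terms of the expansions are integrals over the interval between
[x] and [z]; they tend to [0] by absolute continuity of the integral of [g].  The
bound [D] is kept apart: for [sinh(z - y)] it is of order [|z - x|], which makes
the correction negligible even after division by [z - x]. *)
Lemma crossing_integral_small x g e : exp_integrable g -> 0 < e ->
  exists2 d : R, 0 < d &
  forall z c D, `|z - x| < d -> measurable_fun setT c -> 0 <= D ->
    (forall y, `|y - x| <= `|z - x| -> `|c y| <= D) ->
  `|\int[mu]_y (crossing x z y * c y * g y)| <= D * e.
Proof.
move=> wg e0.
pose B := `[x - 1, x + 1]%classic : set R.
pose h := fun y => \1_B y * g y.
have ih : mu.-integrable setT (EFin \o h).
  apply: (@exp_integrable_mul _ _ (expR (`|x| + 1))) => //.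
    by apply: measurable_indic; exact: measurable_itv.
  move=> y.
  rewrite -expRD indicE; have [yB|_] := boolP (y \in B).
    rewrite normr1 -{1}(@expR0 R) ler_expR.
    move: yB; rewrite inE /B/= in_itv/= => /andP[y1 y2].
    have : `|y - x| <= 1 by rewrite ler_norml; lra.
    have := ler_normD (y - x) x; rewrite subrK; lra.
  by rewrite normr0 expR_ge0.
have [d [d0 hd]] := integral_normr_continuous ih e0.
(* The interval of radius [|z - x|] about [x] has measure [2 * |z - x| < d]. *)
exists (Num.min 1 (d / 4)); first by rewrite lt_min ltr01 divr_gt0.
move=> z c D; rewrite lt_min => /andP[z1 zd] mc D0 cD.
have isc : mu.-integrable setT (EFin \o (fun y => crossing x z y * c y * g y)).
  apply: (exp_integrable_mul _ wg (crossing_mul_le D0 cD)).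
  by apply: measurable_funM => //; exact: measurable_crossing.
pose A := `[x - `|z - x|, x + `|z - x|]%classic : set R.
have Ad : (mu A < d%:E)%E.
  rewrite lebesgue_measure_itv/=; case: ifP => _; last by rewrite lte_fin.
  by rewrite -EFinD lte_fin; lra.
have mA : measurable A by exact: measurable_itv.
have := hd A mA Ad; rewrite Rintegral_mkcond => hA.
have ihA : mu.-integrable setT (EFin \o ((fun y => `|h y|) \_ A)).
  rewrite -restrict_EFin; apply: (@integrable_mkcond _ _ _ mu A _ mA).1.
  by apply: integrableS (integrable_norm ih).
rewrite (le_trans (le_normr_Rintegral measurableT isc))//.
apply: (@le_trans _ _ (D * \int[mu]_y ((fun y => `|h y|) \_ A) y)); last first.
  by rewrite ler_wpM2l// ltW.
rewrite -RintegralZl//; apply: le_Rintegral => //.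
- exact: integrable_norm isc.
- by have := integrableZl measurableT D ihA; exact: eq_integrable.
- move=> y _.
  have [->|s0] := eqVneq (crossing x z y) 0.
    rewrite !mul0r normr0 mulr_ge0//; apply: restrict_ge0 => //.
  have yx := crossing_neq0 s0.
  rewrite patchE ifT; last first.
    by rewrite inE /A/= in_itv/= -ler_distlC distrC.
  have yB : y \in B by rewrite inE /B/= in_itv/= -ler_distlC distrC; lra.
  rewrite /= /h indicE yB.
  rewrite !normrM -mulrA normr1 mul1r mulrA ler_wpM2r//.
  by rewrite -[leRHS]mul1r ler_pM ?norm_crossing_le1 ?cD.
Qed.

End weighted.

(** * The derivative of the convolution *)

(** [is_derive_helmholtz_inv] shows that this is the derivative of
[helmholtz_inv g]. *)
Definition dhelmholtz_inv (R : realType) (g : R -> R) (x : R) : R :=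
  \int[@lebesgue_measure R]_y (dgreen x y * g y).

Section helmholtz.
Variable R : realType.
Local Notation mu := (@lebesgue_measure R).
Local Notation helm := (@helmholtz_inv R).
Implicit Types (g k c : R -> R) (x y z C D e : R).

Lemma Rintegral_lin3 (f1 f2 f3 : R -> R) (a b : R) :
  mu.-integrable setT (EFin \o f1) -> mu.-integrable setT (EFin \o f2) ->
  mu.-integrable setT (EFin \o f3) ->
  \int[mu]_y (a * f1 y + b * f2 y - f3 y) =
  a * \int[mu]_y f1 y + b * \int[mu]_y f2 y - \int[mu]_y f3 y.
Proof.
move=> i1 i2 i3.
have ia : mu.-integrable setT (EFin \o (fun y => a * f1 y)).
  by have := integrableZl measurableT a i1; exact: eq_integrable.
have ib : mu.-integrable setT (EFin \o (fun y => b * f2 y)).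
  by have := integrableZl measurableT b i2; exact: eq_integrable.
rewrite RintegralB//; last first.
  by have := integrableD measurableT ia ib; exact: eq_integrable.
by rewrite RintegralD// !RintegralZl.
Qed.

Lemma measurable_cosh z : measurable_fun setT (fun y => coshR (z - y)).
Proof.
apply: continuous_measurable_fun => y.
apply: (@continuous_comp _ _ _ (fun y : R => z - y) (@coshR R)).
  by apply: cvgB; [exact: cvg_cst|exact: cvg_id].
exact: continuous_coshR.
Qed.

Lemma measurable_sinh z : measurable_fun setT (fun y => sinhR (z - y)).
Proof.
apply: continuous_measurable_fun => y.
apply: (@continuous_comp _ _ _ (fun y : R => z - y) (@sinhR R)).
  by apply: cvgB; [exact: cvg_cst|exact: cvg_id].
exact: continuous_sinhR.
Qed.

Lemma near_dist2 x z y : `|y - x| <= `|z - x| -> `|z - y| <= 2 * `|z - x|.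
Proof. by have := ler_distD x z y; rewrite (distrC x y); lra. Qed.

Lemma cosh_near_le x z y : `|z - x| <= 1 -> `|y - x| <= `|z - x| ->
  `|coshR (z - y)| <= expR 2.
Proof.
move=> zx /near_dist2 zy; apply: le_trans (coshR_le _) _.
by rewrite ler_expR; lra.
Qed.

Lemma sinh_near_le x z y : `|z - x| <= 1 -> `|y - x| <= `|z - x| ->
  `|sinhR (z - y)| <= 2 * `|z - x| * expR 2.
Proof.
move=> zx /near_dist2 zy; apply: le_trans (sinhR_le _) _.
by apply: ler_pM; rewrite ?expR_ge0// ler_expR; lra.
Qed.

Lemma integrable_green g x : exp_integrable g ->
  mu.-integrable setT (EFin \o (fun y => green x y * g y)).
Proof.
by move=> wg; apply: exp_integrable_mul wg (green_le x); exact: measurable_green.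
Qed.

Lemma integrable_dgreen g x : exp_integrable g ->
  mu.-integrable setT (EFin \o (fun y => dgreen x y * g y)).
Proof.
by move=> wg; apply: exp_integrable_mul wg (dgreen_le x); exact: measurable_dgreen.
Qed.

Lemma integrable_crossing_mul g x z c : exp_integrable g -> continuous c ->
  mu.-integrable setT (EFin \o (fun y => crossing x z y * c y * g y)).
Proof.
move=> wg cc.
have [D D0 cD] : exists2 C, 0 <= C &
    forall y, `[x - `|z - x|, x + `|z - x|]%classic y -> `|c y| <= C.
  by apply: compact_bounded_fun => [|y _]; [exact: segment_compact|exact: cc].
apply: (exp_integrable_mul _ wg (@crossing_mul_le _ x z c D D0 _)).
  apply: measurable_funM; first exact: measurable_crossing.
  exact: continuous_measurable_fun.
by move=> y yx; apply: cD; rewrite /= in_itv/= -ler_distlC distrC.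
Qed.

Lemma continuous_subl (h : R -> R) z : continuous h -> continuous (fun y => h (z - y)).
Proof.
move=> ch y; apply: (@continuous_comp _ _ _ (fun y : R => z - y) h); last exact: ch.
by apply: cvgB; [exact: cvg_cst|exact: cvg_id].
Qed.

Lemma helmholtz_inv_expand g x z : exp_integrable g -> helm g z =
  coshR (z - x) * helm g x + sinhR (z - x) * dhelmholtz_inv g x -
  \int[mu]_y (crossing x z y * sinhR (z - y) * g y).
Proof.
move=> wg; rewrite -Rintegral_lin3; last first.
- by apply: integrable_crossing_mul => //; apply: continuous_subl; exact: continuous_sinhR.
- exact: integrable_dgreen.
- exact: integrable_green.
apply: eq_Rintegral => y _; rewrite -/(green z y) -/(green x y) (green_expand x); ring.
Qed.

Lemma dhelmholtz_inv_expand g x z : exp_integrable g -> dhelmholtz_inv g z =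
  sinhR (z - x) * helm g x + coshR (z - x) * dhelmholtz_inv g x -
  \int[mu]_y (crossing x z y * coshR (z - y) * g y).
Proof.
move=> wg; rewrite -Rintegral_lin3; last first.
- by apply: integrable_crossing_mul => //; apply: continuous_subl; exact: continuous_coshR.
- exact: integrable_dgreen.
- exact: integrable_green.
apply: eq_Rintegral => y _; rewrite (dgreen_expand x) -/(green x y); ring.
Qed.

Lemma is_derive_shift (f : R -> R) (d x : R) : is_derive (0 : R) 1 f d ->
  is_derive x 1 (fun z => f (z - x)) d.
Proof.
move=> fd; have fd' : is_derive (x - x) 1 f d by rewrite subrr.
rewrite -[d]mulr1; apply: (@is_derive1_comp _ f (fun z => z - x)) => //.
rewrite -[X in is_derive _ _ _ X]subr0.
by apply: is_deriveB.
Qed.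

(** The smooth part of both expansions, as a function of the end point. *)
Lemma is_derive_frame x a b :
  is_derive x 1 (fun z => coshR (z - x) * a + sinhR (z - x) * b) b.
Proof.
have c0 : is_derive (0 : R) 1 (@coshR R) 0.
  by have := @is_derive_coshR R 0; rewrite sinhR0.
have s0 : is_derive (0 : R) 1 (@sinhR R) 1.
  by have := @is_derive_sinhR R 0; rewrite coshR0.
have h1 := is_deriveZ a (is_derive_shift x c0).
have h2 := is_deriveZ b (is_derive_shift x s0).
rewrite (_ : (fun z => _) = a \*: (fun z => coshR (z - x)) +
                            b \*: (fun z => sinhR (z - x))); last first.
  by apply/funext => z; rewrite !fctE /= mulrC [X in _ + X]mulrC.
by have := is_deriveD h1 h2; rewrite scaler0 add0r [b *: 1]mulr1.
Qed.

(** The correction term is an integral over the interval between [x] and [z] of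
[g] times a hyperbolic sine of size [O(|z - x|)], hence it is [o(|z - x|)] with no
continuity of [g]. *)
Lemma is_derive_helmholtz_inv g x : exp_integrable g ->
  is_derive x 1 (helm g) (dhelmholtz_inv g x).
Proof.
move=> wg; apply/is_derive_eps => e e0.
pose F z := coshR (z - x) * helm g x + sinhR (z - x) * dhelmholtz_inv g x.
have Fx : F x = helm g x by rewrite /F subrr coshR0 sinhR0 mul1r mul0r addr0.
have e20 : 0 < e / 2 by rewrite divr_gt0.
have /is_derive_eps/(_ _ e20)/nbhs_ballP[r /= r0 Fr] :=
  is_derive_frame x (helm g x) (dhelmholtz_inv g x).
pose K := expR 2 : R.
have K0 : 0 < K by exact: expR_gt0.
have e10 : 0 < e / 2 / (2 * K) by rewrite !divr_gt0// mulr_gt0.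
have [d d0 hd] := crossing_integral_small x wg e10.
apply/nbhs_ballP; exists (Num.min (Num.min 1 d) r).
  by rewrite /= !lt_min ltr01 d0.
move=> z; rewrite /ball/= !lt_min => /andP[/andP[xz1 xzd] xzr].
rewrite (helmholtz_inv_expand x z wg) -/(F z) -Fx.
have zx1 : `|z - x| <= 1 by rewrite distrC ltW.
have zd : `|z - x| < d by rewrite distrC.
have small := hd z (fun y => sinhR (z - y)) (2 * `|z - x| * K) zd
  (measurable_sinh z) _ _.
set I := \int[mu]_y _ in small *.
rewrite (_ : _ - _ = (F z - F x - (z - x) * dhelmholtz_inv g x) - I); last by ring.
rewrite (le_trans (ler_normB _ _))//.
rewrite (_ : e * _ =
    e / 2 * `|z - x| + 2 * `|z - x| * K * (e / 2 / (2 * K))); last first.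
  by field; rewrite gt_eqF.
apply: lerD; first exact: Fr.
apply: small; first by rewrite !mulr_ge0// ltW.
by move=> y; exact: sinh_near_le.
Qed.

(** Here the correction carries a hyperbolic cosine, which is merely bounded, so
that it is [o(1)]. *)
Lemma continuous_dhelmholtz_inv g : exp_integrable g -> continuous (dhelmholtz_inv g).
Proof.
move=> wg x; apply/cvgrPdist_le => e e0.
pose F z := coshR (z - x) * dhelmholtz_inv g x + sinhR (z - x) * helm g x.
have Fx : F x = dhelmholtz_inv g x by rewrite /F subrr coshR0 sinhR0 mul1r mul0r addr0.
have e20 : 0 < e / 2 by rewrite divr_gt0.
have cF : F z @[z --> x] --> F x.
  exact: is_derive_continuous (is_derive_frame x (dhelmholtz_inv g x) (helm g x)).
have /cvgrPdist_le/(_ _ e20)/nbhs_ballP[r /= r0 Fr] := cF.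
pose K := expR 2 : R.
have K0 : 0 < K by exact: expR_gt0.
have e10 : 0 < e / 2 / K by rewrite !divr_gt0.
have [d d0 hd] := crossing_integral_small x wg e10.
apply/nbhs_ballP; exists (Num.min (Num.min 1 d) r).
  by rewrite /= !lt_min ltr01 d0.
move=> z; rewrite /ball/= !lt_min => /andP[/andP[xz1 xzd] xzr].
rewrite (dhelmholtz_inv_expand x z wg) (addrC (sinhR _ * _)) -/(F z) -Fx.
have zx1 : `|z - x| <= 1 by rewrite distrC ltW.
have zd : `|z - x| < d by rewrite distrC.
have small := hd z (fun y => coshR (z - y)) K zd (measurable_cosh z) (ltW K0) _.
set I := \int[mu]_y _ in small *.
rewrite opprB addrCA addrC (le_trans (ler_normD _ _))// [leRHS]splitr.
apply: lerD; first exact: Fr.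
rewrite (le_trans (small _))//; first by move=> y; exact: cosh_near_le.
by rewrite mulrC divfK// gt_eqF.
Qed.

End helmholtz.

(** * The second derivative where the function is continuous *)
Section helmholtz_local.
Variable R : realType.
Local Notation mu := (@lebesgue_measure R).
Implicit Types (g G : R -> R) (x y z e : R).

Lemma ae_imp (P Q : R -> Prop) : (forall y, P y -> Q y) ->
  {ae mu, forall y, P y} -> {ae mu, forall y, Q y}.
Proof.
by move=> PQ; apply: filterS PQ; exact: (ae_filter_ringOfSetsType mu).
Qed.

Lemma ae_imp2 (P Q S : R -> Prop) : (forall y, P y -> Q y -> S y) ->
  {ae mu, forall y, P y} -> {ae mu, forall y, Q y} -> {ae mu, forall y, S y}.
Proof.
by move=> PQ; apply: filterS2 PQ; exact: (ae_filter_ringOfSetsType mu).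
Qed.

Lemma ae_le_Rintegral (f1 f2 : R -> R) :
  mu.-integrable setT (EFin \o f1) -> mu.-integrable setT (EFin \o f2) ->
  (forall y, 0 <= f1 y) -> (forall y, 0 <= f2 y) ->
  {ae mu, forall y, f1 y <= f2 y} ->
  \int[mu]_y f1 y <= \int[mu]_y f2 y.
Proof.
move=> i1 i2 f10 f20 h; apply: fine_le; rewrite ?integrable_fin_num//.
apply: ae_ge0_le_integral => //.
- by move=> y _; rewrite lee_fin.
- exact: measurable_int i1.
- by move=> y _; rewrite lee_fin.
- exact: measurable_int i2.
- by move: h; apply: ae_imp => y h _; rewrite lee_fin.
Qed.

Lemma integrable_indic_oc x z :
  mu.-integrable setT (EFin \o (fun y => \1_`]x, z] y : R)).
Proof. exact: integrable_indic_itv. Qed.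

Lemma integral_indic_oc x z : \int[mu]_y (\1_`]x, z] y : R) = Num.max 0 (z - x).
Proof.
have E : (\int[mu]_y (\1_`]x, z] y)%:E = mu (`]x, z]%classic : set R))%E.
  by rewrite (@integral_indic _ _ _ mu _ measurableT)// setIT.
rewrite /Rintegral E lebesgue_measure_itv/= lte_fin.
case: ltP => xz /=; first by rewrite max_r// subr_ge0 ltW.
by rewrite max_l// subr_le0.
Qed.

Lemma integrable_crossing x z : mu.-integrable setT (EFin \o crossing x z).
Proof.
rewrite crossingE.
by have := integrableB measurableT (integrable_indic_oc x z) (integrable_indic_oc z x);
  exact: eq_integrable.
Qed.

Lemma integral_crossing x z : \int[mu]_y crossing x z y = z - x.
Proof.
rewrite crossingE RintegralB//; try exact: integrable_indic_oc.
rewrite !integral_indic_oc; case: (leP x z) => xz.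
  by rewrite max_r ?subr_ge0// max_l ?subr_le0// subr0.
by rewrite max_l ?subr_le0 ?ltW// max_r ?subr_ge0 ?ltW// sub0r opprB.
Qed.

Lemma norm_crossingE x z y : `|crossing x z y| = \1_`]x, z] y + \1_`]z, x] y.
Proof.
rewrite !indicE !mem_setE !in_itv/= /crossing.
by have [xy|yx] := ltP x y; have [yz|zy] := leP y z;
  rewrite /= ?subrr ?subr0 ?sub0r ?addr0 ?add0r ?normrN ?normr0 ?normr1.
Qed.

Lemma integral_norm_crossing x z : \int[mu]_y `|crossing x z y| = `|z - x|.
Proof.
under eq_Rintegral do rewrite norm_crossingE.
rewrite RintegralD//; try exact: integrable_indic_oc.
rewrite !integral_indic_oc; case: (leP x z) => xz.
  by rewrite max_r ?subr_ge0// max_l ?subr_le0// addr0 ger0_norm ?subr_ge0.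
rewrite max_l ?subr_le0 ?ltW// max_r ?subr_ge0 ?ltW// add0r.
by rewrite ltr0_norm ?subr_lt0// opprB.
Qed.

(** Where [g] is almost everywhere equal to a function [G] continuous at [x], the
correction is [(z - x) * G x + o(|z - x|)]; this is the equation
[(1 - d^2/dx^2) helmholtz_inv g = G]. *)
Lemma is_derive_dhelmholtz_inv (O : set R) g G x : open O -> O x -> exp_integrable g ->
  ae_eq_on O g G -> {for x, continuous G} ->
  is_derive x 1 (dhelmholtz_inv g) (helmholtz_inv g x - G x).
Proof.
move=> oO Ox wg gG cG; apply/is_derive_eps => e e0.
pose h := helmholtz_inv g.
pose F z := coshR (z - x) * dhelmholtz_inv g x + sinhR (z - x) * h x.
have Fx : F x = dhelmholtz_inv g x by rewrite /F subrr coshR0 sinhR0 mul1r mul0r addr0.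
have e20 : 0 < e / 2 by rewrite divr_gt0.
have /is_derive_eps/(_ _ e20)/nbhs_ballP[r /= r0 Fr] :=
  is_derive_frame x (dhelmholtz_inv g x) (h x).
have [d d0 dG] : exists2 d : R, 0 < d & forall w y, `|w| < d -> `|y - x| < d ->
    O y /\ `|coshR w * G y - G x| <= e / 2.
  have cp : (fun p : R * R => coshR p.1 * G p.2) p @[p --> (0, x)] --> coshR 0 * G x.
    have c1 : coshR p.1 @[p --> (0 : R, x)] --> coshR (0 : R).
      apply: (@cvg_comp _ _ _ (@fst R R) (@coshR R) _ (nbhs (0 : R))).
        exact: cvg_fst.
      exact: continuous_coshR.
    have c2 : G p.2 @[p --> (0 : R, x)] --> G x.
      apply: (@cvg_comp _ _ _ (@snd R R) G _ (nbhs x)) => //.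
      exact: cvg_snd.
    exact: cvgM c1 c2.
  have /cvgrPdist_le/(_ _ e20)/nbhs_ballP[d1 /= d10 h1] := cp.
  have /nbhs_ballP[d2 /= d20 h2] : \forall y \near x, O y by exact: open_nbhs_nbhs.
  exists (Num.min d1 d2); first by rewrite lt_min d10.
  move=> w y; rewrite !lt_min => /andP[w1 _] /andP[y1 y2]; split.
    by apply: h2; rewrite /ball/= distrC.
  have := h1 (w, y); rewrite coshR0 mul1r distrC; apply.
  by split; rewrite /ball/= ?sub0r ?normrN// distrC.
apply/nbhs_ballP; exists (Num.min (d / 2) r); first by rewrite /= lt_min r0 divr_gt0.
move=> z; rewrite /ball/= !lt_min => /andP[xzd xzr].
rewrite (dhelmholtz_inv_expand x z wg) (addrC (sinhR _ * _)) -/(h x) -/(F z) -Fx.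
pose f1 y := crossing x z y * coshR (z - y) * g y.
pose f2 y := crossing x z y * G x.
have i1 : mu.-integrable setT (EFin \o f1).
  apply: (@integrable_crossing_mul _ _ x z (fun y => coshR (z - y)) wg).
  by apply: continuous_subl; exact: continuous_coshR.
have i2 : mu.-integrable setT (EFin \o f2).
  have := integrableZl measurableT (G x) (integrable_crossing x z).
  by apply: eq_integrable => // y _ /=; rewrite /f2 mulrC EFinM.
have I2 : \int[mu]_y f2 y = (z - x) * G x.
  by rewrite /f2 RintegralZr ?integral_crossing//; exact: integrable_crossing.
have i12 : mu.-integrable setT (EFin \o (fun y => f1 y - f2 y)).
  by have := integrableB measurableT i1 i2; exact: eq_integrable.
rewrite -/f1.
rewrite (_ : _ - _ - _ = (F z - F x - (z - x) * h x) -
    (\int[mu]_y f1 y - \int[mu]_y f2 y)); last first.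
  by rewrite I2; ring.
rewrite -RintegralB//.
rewrite (le_trans (ler_normB _ _))// [X in _ <= X * _](splitr e) [leRHS]mulrDl.
apply: lerD; first exact: Fr.
rewrite (le_trans (le_normr_Rintegral measurableT i12))//.
have ins := integrable_norm (integrable_crossing x z).
rewrite -integral_norm_crossing -RintegralZl//.
apply: ae_le_Rintegral => //.
- exact: integrable_norm i12.
- by have := integrableZl measurableT (e / 2) ins; exact: eq_integrable.
- by move=> y; rewrite mulr_ge0// ltW.
move: gG; apply: ae_imp => y gGy.
rewrite /f1 /f2 -mulrA -mulrBr normrM mulrC.
have [->|s0] := eqVneq (crossing x z y) 0; first by rewrite normr0 !mulr0.
have yx := crossing_neq0 s0.
have [||Oy ch] := dG (z - y) y.
- by rewrite (le_lt_trans (near_dist2 yx))// distrC; lra.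
- by rewrite (le_lt_trans yx)// distrC; lra.
by rewrite ler_wpM2r// gGy.
Qed.

End helmholtz_local.

(** * Square integrable functions *)
Section L2.
Variable R : realType.
Local Notation mu := (@lebesgue_measure R).
Implicit Types (f g h : R -> R).

Definition normL2 f : R := fine (L2norm f).

Lemma L2P f : L2 f <-> measurable_fun setT f /\ (L2norm f < +oo)%E.
Proof.
rewrite /L2; split => [/andP[]|[mf nf]]; first by rewrite !inE.
by apply/andP; rewrite !inE.
Qed.

Lemma L2norm_ge0 f : (0 <= L2norm f)%E. Proof. exact: Lnorm_ge0. Qed.

Lemma normL2_ge0 f : 0 <= normL2 f. Proof. by rewrite fine_ge0// L2norm_ge0. Qed.

Lemma normL2E f : L2 f -> L2norm f = (normL2 f)%:E.
Proof. by move=> /L2P[_ nf]; rewrite fineK// ge0_fin_numE// L2norm_ge0. Qed.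

Lemma L2_measurable f : L2 f -> measurable_fun setT f.
Proof. by move=> /L2P[]. Qed.

Let le12 : (1 <= 2%:E :> \bar R)%E. Proof. by rewrite lee_fin ler1n. Qed.

Lemma L2norm_le f g : measurable_fun setT f -> measurable_fun setT g ->
  (forall y, `|f y| <= `|g y|) -> (L2norm f <= L2norm g)%E.
Proof.
move=> mf mg fg; rewrite /L2norm unlock /=.
rewrite gt0_ler_poweR ?invr_ge0//.
- by rewrite in_itv/= leey integral_ge0.
- by rewrite in_itv/= leey integral_ge0.
apply: ge0_le_integral => //.
- apply/measurable_EFinP.
  apply: (@measurableT_comp _ _ _ _ _ _ (fun x : R => x `^ 2)) => //.
  exact: measurableT_comp.
- apply/measurable_EFinP.
  apply: (@measurableT_comp _ _ _ _ _ _ (fun x : R => x `^ 2)) => //.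
  exact: measurableT_comp.
- by move=> y _; rewrite lee_fin ge0_ler_powR ?nnegrE.
Qed.

Lemma L2_le f g : measurable_fun setT f -> L2 g ->
  (forall y, `|f y| <= `|g y|) -> L2 f.
Proof.
move=> mf /L2P[mg ng] fg; apply/L2P; split=> //.
exact: le_lt_trans (L2norm_le mf mg fg) ng.
Qed.

Lemma normL2_le f g : measurable_fun setT f -> L2 g ->
  (forall y, `|f y| <= `|g y|) -> normL2 f <= normL2 g.
Proof.
move=> mf Lg fg; have Lf := L2_le mf Lg fg.
rewrite -lee_fin -!normL2E//; apply: L2norm_le => //; exact: L2_measurable.
Qed.

Lemma L2D f g : L2 f -> L2 g -> L2 (fun y => f y + g y).
Proof.
move=> Lf Lg; have [mf nf] := (L2P f).1 Lf; have [mg ng] := (L2P g).1 Lg.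
apply/L2P; split; first exact: measurable_funD.
rewrite (le_lt_trans (@minkowski_EFin _ _ _ mu f g 2 mf mg _))//.
exact: lte_add_pinfty.
Qed.

Lemma normL2D f g : L2 f -> L2 g -> normL2 (fun y => f y + g y) <= normL2 f + normL2 g.
Proof.
move=> Lf Lg; have Lfg := L2D Lf Lg.
rewrite -lee_fin EFinD -!normL2E//.
by apply: minkowski_EFin; rewrite ?ler1n//; exact: L2_measurable.
Qed.

Lemma L2Z a f : L2 f -> L2 (fun y => a * f y).
Proof.
move=> Lf; have -> : (fun y => a * f y) = a \o* f.
  by apply/funext => y /=; rewrite mulrC.
by apply: Lfun_scale => //; rewrite ler1n.
Qed.

Lemma normL2Z a f : L2 f -> normL2 (fun y => a * f y) = `|a| * normL2 f.
Proof.
move=> Lf; have := @LnormZ _ _ R mu _ le12 (Lfun_Sub le12 Lf) a.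
move=> /(congr1 fine); rewrite fineM//=.
by have := normL2E Lf; rewrite /L2norm => ->.
Qed.

Lemma L2N f : L2 f -> L2 (fun y => - f y).
Proof. by move=> /(L2Z (-1)); congr L2; apply/funext => y; rewrite mulN1r. Qed.

Lemma normL2N f : L2 f -> normL2 (fun y => - f y) = normL2 f.
Proof.
move=> Lf; rewrite -[RHS]mul1r -(normr1 R) -normrN -normL2Z//.
by congr normL2; apply/funext => y; rewrite mulN1r.
Qed.

Lemma L2B f g : L2 f -> L2 g -> L2 (fun y => f y - g y).
Proof. by move=> Lf Lg; apply: L2D => //; exact: L2N. Qed.

Lemma normL2B f g : L2 f -> L2 g -> normL2 (fun y => f y - g y) <= normL2 f + normL2 g.
Proof. by move=> Lf Lg; rewrite -(normL2N Lg); apply: normL2D => //; exact: L2N. Qed.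

Lemma normL2_dist f g : L2 f -> L2 g ->
  `|normL2 f - normL2 g| <= normL2 (fun y => f y - g y).
Proof.
move=> Lf Lg; have Lfg := L2B Lf Lg; have Lgf := L2B Lg Lf.
have h1 : normL2 f <= normL2 (fun y => f y - g y) + normL2 g.
  have := normL2D Lfg Lg; congr (normL2 _ <= _).
  by apply/funext => y; rewrite subrK.
have h2 : normL2 g <= normL2 (fun y => f y - g y) + normL2 f.
  have := normL2D (L2N Lfg) Lf; rewrite normL2N//; congr (normL2 _ <= _).
  by apply/funext => y; rewrite opprB subrK.
by rewrite ler_norml; lra.
Qed.

Lemma L2_mul_integrable f g : L2 f -> L2 g ->
  mu.-integrable setT (EFin \o (fun y => f y * g y)).
Proof. by move=> Lf Lg; apply/Lfun1_integrable; exact: Lfun2_mul_Lfun1. Qed.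

Lemma cauchy_schwarz f g : L2 f -> L2 g ->
  \int[mu]_y `|f y * g y| <= normL2 f * normL2 g.
Proof.
move=> Lf Lg; rewrite -lee_fin EFinM -!normL2E//.
have ifg := integrable_norm (L2_mul_integrable Lf Lg).
rewrite fineK ?integrable_fin_num//.
have := @hoelder _ _ _ mu f g 2 2 (L2_measurable Lf) (L2_measurable Lg).
rewrite Lnorm1; apply => //.
by rewrite [RHS]splitr !div1r.
Qed.

Lemma normL2_eq0 f : L2 f -> normL2 f = 0 -> {ae mu, forall y, f y = 0}.
Proof.
move=> Lf f0; have nf := normL2E Lf; rewrite f0 in nf.
have mf : measurable_fun setT (EFin \o f).
  by apply/measurable_EFinP; exact: L2_measurable.
have p0 : (0 < 2%:E :> \bar R)%E by rewrite lte_fin.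
have := @Lnorm_eq0_eq0 _ _ _ mu _ 2%:E mf p0 nf.
by apply: ae_imp => y /(_ I) /= [].
Qed.

Lemma integrable_sqr_L2 f : measurable_fun setT f ->
  (\int[mu]_y (f y ^+ 2)%:E < +oo)%E -> L2 f.
Proof.
move=> mf sf; apply/L2P; split=> //.
rewrite /L2norm unlock poweR_lty//.
by under eq_integral => y _ do rewrite /= powR_mulrn// -normrX ger0_norm ?sqr_ge0//.
Qed.

(** By symmetry it suffices to integrate over the half line, where the square of
the weight is at most the density of the exponential law of rate 2. *)
Lemma L2_weight : L2 (fun y : R => expR (- `|y|)).
Proof.
apply: integrable_sqr_L2; first exact: measurable_weight.
have cw : continuous (fun y : R => expR (- `|y|) ^+ 2).
  move=> y; apply: (@continuous_comp _ _ _ (fun y : R => expR (- `|y|))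
    (fun z => z ^+ 2)).
    apply: (@continuous_comp _ _ _ (fun y : R => - `|y|) expR).
      by apply: cvgN; exact: norm_continuous.
    exact: continuous_expR.
  exact: exprn_continuous.
rewrite ge0_symfun_integralT//; last first.
- by move=> y /=; rewrite normrN.
rewrite lte_mul_pinfty//.
have r0 : 0 < 2 :> R by [].
have mpos : measurable [set x : R | 0 <= x] by rewrite -set_itvcy.
have ipdf := integrable_exponential_pdf r0.
apply: (@le_lt_trans _ _ (\int[mu]_(x in [set x | (0 <= x)%R])
    (exponential_pdf 2 x)%:E)%E).
  apply: ge0_le_integral => //.
  - by apply/measurable_EFinP/measurable_funTS; exact: continuous_measurable_fun.
  - by apply/measurable_EFinP/measurable_funTS; exact: measurable_exponential_pdf.
  move=> y y0; rewrite lee_fin exponential_pdfE// ger0_norm// -expRM_natl.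
  have -> : 2 * - y = - 2 * y by ring.
  by have := expR_ge0 (- 2 * y); lra.
apply: integrable_lty => //; exact: integrableS ipdf.
Qed.

Lemma L2_indic (a b : R) : L2 (\1_`[a, b] : R -> R).
Proof.
apply: integrable_sqr_L2; first exact: measurable_indic.
have E : (\int[mu]_y ((\1_`[a, b] y : R) ^+ 2)%:E = mu (`[a, b]%classic : set R))%E.
  rewrite -[RHS](_ : (\int[mu]_y (\1_`[a, b] y)%:E) = _)%E; last first.
    by rewrite (@integral_indic _ _ _ mu _ measurableT)// setIT.
  apply: eq_integral => y _; congr EFin; rewrite indicE.
  by case: (y \in _); rewrite ?expr1n ?expr0n.
rewrite E lebesgue_measure_itv/=; case: ifP => _; last by rewrite ltry.
by rewrite -EFinD ltry.
Qed.

End L2.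

(** * Continuous dependence of the kernels on the solution *)
Definition flux (R : realType) (f : R -> R) (y : R) : R := f y + f y ^+ 2 / 2.

Section flux.
Variable R : realType.
Local Notation mu := (@lebesgue_measure R).
Implicit Types (f g : R -> R).
Let weight := fun y : R => expR (- `|y|).

Lemma exp_integrable_flux f : L2 f -> exp_integrable (flux f).
Proof.
move=> Lf; have mf := L2_measurable Lf.
have mflux : measurable_fun setT (flux f).
  apply: measurable_funD => //; apply: measurable_funM => //.
  exact: measurable_funX.
split=> //.
have i1 := L2_mul_integrable (@L2_weight R) Lf.
have i2 := L2_mul_integrable Lf Lf.
have i3 : mu.-integrable setT (EFin \o (fun y => weight y * (f y ^+ 2 / 2))).
  apply: le_integrable i2 => //.
    apply/measurable_EFinP; apply: measurable_funM; first exact: measurable_weight.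
    by apply: measurable_funM => //; exact: measurable_funX.
  move=> y _ /=; rewrite lee_fin -expr2 normrM ger0_norm ?expR_ge0//.
  rewrite -[leRHS]mul1r ler_pM ?expR_ge0//.
    by rewrite /weight -[leRHS](@expR0 R) ler_expR oppr_le0.
  by rewrite normrM (@ger0_norm _ 2^-1)// ler_piMr// invf_le1// ler1n.
have := integrableD measurableT i1 i3; apply: eq_integrable => // y _ /=.
by rewrite -EFinD -mulrDr.
Qed.

(** With [d = f - g] the difference of the fluxes is [d + d * g + d^2 / 2]; the
first term is paired with the weight, and in the others the weight is bounded
by 1. *)
Lemma exp_norm_flux f g : L2 f -> L2 g ->
  exp_norm (fun y => flux f y - flux g y) <=
  normL2 (fun y => f y - g y) *
    (normL2 weight + normL2 g + normL2 (fun y => f y - g y)).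
Proof.
move=> Lf Lg; pose d := fun y => f y - g y; have Ld : L2 d by exact: L2B.
have Lw : L2 weight by exact: L2_weight.
have iwd := integrable_norm (L2_mul_integrable Lw Ld).
have idg := integrable_norm (L2_mul_integrable Ld Lg).
have idd := integrable_norm (L2_mul_integrable Ld Ld).
have isum : mu.-integrable setT (EFin \o
    (fun y => `|weight y * d y| + `|d y * g y| + `|d y * d y|)).
  by have := integrableD measurableT (integrableD measurableT iwd idg) idd;
     exact: eq_integrable.
apply: (@le_trans _ _ (\int[mu]_y (`|weight y * d y| + `|d y * g y| + `|d y * d y|))).
  apply: le_Rintegral => //.
    have [mf wf] := exp_integrable_flux Lf; have [mg wg] := exp_integrable_flux Lg.
    apply: exp_integrable_norm; split; first exact: measurable_funB.
    have := integrableB measurableT wf wg; apply: eq_integrable => // y _ /=.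
    by rewrite -EFinB -mulrBr.
  move=> y _; have -> : flux f y - flux g y = d y + d y * g y + d y * d y / 2.
    by rewrite /flux /d; field.
  have w0 : 0 <= weight y by exact: expR_ge0.
  have w1 : weight y <= 1 by rewrite /weight -[leRHS](@expR0 R) ler_expR oppr_le0.
  rewrite -/(weight y); move: (d y) (g y) (weight y) w0 w1 => a b w w0 w1.
  apply: (@le_trans _ _ (w * (`|a| + `|a * b| + `|a * a|))).
    rewrite ler_wpM2l// (le_trans (ler_normD _ _))// lerD ?ler_normD//.
    by rewrite [leLHS]normrM (@ger0_norm _ 2^-1)// ler_piMr// invf_le1// ler1n.
  rewrite !mulrDr lerD//; last by rewrite ler_piMl.
  by rewrite lerD ?ler_piMl// [leRHS]normrM (ger0_norm w0).
rewrite RintegralD//; last first.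
  by have := integrableD measurableT iwd idg; exact: eq_integrable.
rewrite RintegralD//.
rewrite !mulrDr; apply: lerD; [apply: lerD|]; rewrite ?cauchy_schwarz//.
by rewrite mulrC cauchy_schwarz.
Qed.

Lemma exp_integrableB f g : exp_integrable f -> exp_integrable g ->
  exp_integrable (fun y => f y - g y).
Proof.
move=> [mf wf] [mg wg]; split; first exact: measurable_funB.
have := integrableB measurableT wf wg; apply: eq_integrable => // y _ /=.
by rewrite -EFinB -mulrBr.
Qed.

Lemma dhelmholtz_inv_dist f g x : exp_integrable f -> exp_integrable g ->
  `|dhelmholtz_inv f x - dhelmholtz_inv g x| <=
  2^-1 * expR `|x| * exp_norm (fun y => f y - g y).
Proof.
move=> wf wg; rewrite /dhelmholtz_inv -RintegralB//; try exact: integrable_dgreen.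
have := exp_integrable_mul_le (measurable_dgreen x) (exp_integrableB wf wg)
  (dgreen_le x).
by under eq_Rintegral do rewrite mulrBr.
Qed.

Lemma helmholtz_inv_dist f g x : exp_integrable f -> exp_integrable g ->
  `|helmholtz_inv f x - helmholtz_inv g x| <=
  2^-1 * expR `|x| * exp_norm (fun y => f y - g y).
Proof.
move=> wf wg; rewrite /helmholtz_inv -RintegralB//; try exact: integrable_green.
have := exp_integrable_mul_le (measurable_green x) (exp_integrableB wf wg)
  (green_le x).
by under eq_Rintegral do rewrite mulrBr.
Qed.

Definition L2cont (u : R -> R -> R) := (forall t, L2 (u t)) /\
  forall t0 e, 0 < e -> \forall t \near t0, normL2 (fun x => u t x - u t0 x) <= e.

Lemma L2cont_flux u t0 e : L2cont u -> 0 < e ->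
  \forall t \near t0, exp_norm (fun y => flux (u t) y - flux (u t0) y) <= e.
Proof.
move=> [Lu cu] e0.
pose C := normL2 weight + normL2 (u t0) + 1.
have C0 : 0 < C by rewrite ltr_wpDl// addr_ge0// normL2_ge0.
have eC : 0 < Num.min 1 (e / C) by rewrite lt_min ltr01 divr_gt0.
apply: filterS (cu t0 _ eC) => t; rewrite le_min => /andP[d1 de].
apply: le_trans (exp_norm_flux (Lu _) (Lu _)) _.
have -> : e = e / C * C by rewrite divfK// gt_eqF.
apply: ler_pM => //; first exact: normL2_ge0.
  by rewrite !addr_ge0 ?normL2_ge0.
by rewrite /C lerD2l.
Qed.

(** Continuity in time is locally uniform in [x], by the weighted estimate;
together with continuity in [x] at a fixed time it gives joint continuity. *)
Lemma jcont_kernel (K : (R -> R) -> R -> R) u :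
  (forall f g x, exp_integrable f -> exp_integrable g ->
    `|K f x - K g x| <= 2^-1 * expR `|x| * exp_norm (fun y => f y - g y)) ->
  (forall f, exp_integrable f -> continuous (K f)) ->
  L2cont u -> jcont setT (fun t x => K (flux (u t)) x).
Proof.
move=> Kd cK cu; apply/jcontP => t0 x0 _ e e0.
have Lu := cu.1.
pose C := 2^-1 * expR (`|x0| + 1) : R.
have C0 : 0 < C by rewrite mulr_gt0 ?expR_gt0.
have e20 : 0 < e / 2 by rewrite divr_gt0.
have eC : 0 < e / 3 / C by rewrite !divr_gt0.
have /nbhs_ballP[d1 /= d10 h1] := L2cont_flux t0 cu eC.
have wf t := exp_integrable_flux (Lu t).
have /cvgrPdist_lt/(_ _ e20)/nbhs_ballP[d2 /= d20 h2] := cK _ (wf t0) x0.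
exists (Num.min (Num.min 1 d1) d2); first by rewrite !lt_min ltr01 d10.
move=> t x; rewrite !lt_min => /andP[/andP[_ t1] _] /andP[/andP[x1 _] x2].
rewrite [ltRHS]splitr (le_lt_trans (ler_distD (K (flux (u t0)) x) _ _))// ltrD//.
  apply: (@le_lt_trans _ _ (e / 3)); last by lra.
  apply: le_trans (Kd _ _ _ (wf t) (wf t0)) _.
  have -> : e / 3 = C * (e / 3 / C) by rewrite [RHS]mulrC divfK// gt_eqF.
  apply: ler_pM.
  - by rewrite mulr_ge0 ?expR_ge0.
  - by apply: Rintegral_ge0 => y _; rewrite mulr_ge0 ?expR_ge0.
  - rewrite ler_wpM2l// ler_expR.
    by have := ler_normD (x - x0) x0; rewrite subrK; lra.
  - by apply: h1; rewrite /ball/= distrC.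
by rewrite distrC; apply: h2; rewrite /ball/= distrC.
Qed.

Lemma jcont_dhelmholtz_inv u : L2cont u ->
  jcont setT (fun t x => dhelmholtz_inv (flux (u t)) x).
Proof.
apply: jcont_kernel => [f g x|f]; first exact: dhelmholtz_inv_dist.
exact: continuous_dhelmholtz_inv.
Qed.

Lemma jcont_helmholtz_inv u : L2cont u ->
  jcont setT (fun t x => helmholtz_inv (flux (u t)) x).
Proof.
apply: jcont_kernel => [f g x|f wf x]; first exact: helmholtz_inv_dist.
exact: is_derive_continuous (is_derive_helmholtz_inv x wf).
Qed.

Lemma bbm_rhsE f x : L2 f -> bbm_rhs f x = - dhelmholtz_inv (flux f) x.
Proof.
move=> Lf; rewrite /bbm_rhs -/(flux f); congr (- _).
by rewrite derive1E; have [_ ->] := is_derive_helmholtz_inv x (exp_integrable_flux Lf).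
Qed.

End flux.

(** * Differentiable curves in L^2 *)

(** Composition with the projection onto [[0, T]] extends a curve to all times and
turns one-sided continuity at the end points into two-sided continuity. *)
Section clamp.
Variables (R : realType) (T : R).
Hypothesis T0 : 0 < T.
Implicit Types s t : R.

Definition clamp t : R := Num.max 0 (Num.min t T).

Lemma clamp_ge0 t : 0 <= clamp t. Proof. by rewrite le_max lexx. Qed.

Lemma clamp_le t : clamp t <= T.
Proof. by rewrite ge_max ltW//= ge_min lexx orbT. Qed.

Lemma clamp_in t : clamp t \in `[0, T].
Proof. by rewrite in_itv/= clamp_ge0 clamp_le. Qed.

Lemma clamp_id t : t \in `[0, T] -> clamp t = t.
Proof. by rewrite in_itv/= => /andP[t0 tT]; rewrite /clamp min_l// max_r. Qed.

Lemma clamp_lip s t : `|clamp s - clamp t| <= `|s - t|.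
Proof.
wlog st : s t / s <= t.
  by move=> wl; case: (leP s t) => [/wl//|/ltW/wl]; rewrite distrC (distrC t).
have c : clamp s <= clamp t.
  by rewrite /clamp ge_max !le_max lexx/= le_min !ge_min st lexx !orbT.
rewrite !ler0_norm ?subr_le0// !opprB /clamp.
have := T0.
by case: (leP s T) => sT; case: (leP t T) => tT; rewrite ?(max_r (ltW T0))//;
  case: (leP 0 s) => s0; case: (leP 0 t) => t0; lra.
Qed.

End clamp.

Section evolution.
Variables (R : realType) (T : R).
Hypothesis T0 : 0 < T.
Local Notation mu := (@lebesgue_measure R).
Implicit Types (u v : R -> R -> R).

Lemma L2_time_derivative_error u v : (forall t, t \in `[0, T] -> L2 (u t)) ->
  L2_time_derivative T u v ->
  forall t0 e, t0 \in `[0, T] -> 0 < e ->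
  exists2 d : R, 0 < d & forall t, t \in `[0, T] -> `|t - t0| < d ->
    normL2 (fun x => u t x - u t0 x - (t - t0) * v t0 x) <= e * `|t - t0|.
Proof.
move=> Lu duv t0 e t0T e0; have [Lv] := duv t0 t0T.
move=> /fine_cvgP[_ /cvgrPdist_le/(_ _ e0)/nbhs_ballP[d /= d0 hd]].
exists d => // t tT td.
have [->|tt0] := eqVneq t t0.
  rewrite subrr normr0 mulr0 (_ : (fun _ => _) = fun x => 0 * v t0 x).
    by rewrite normL2Z// normr0 mul0r.
  by apply/funext => x; rewrite subrr mul0r subrr.
have Lq : L2 (fun x => (t - t0)^-1 * (u t x - u t0 x) - v t0 x).
  by apply: L2B => //; apply/L2Z/L2B; exact: Lu.
have := hd t; rewrite /ball/= distrC => /(_ td tt0 tT).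
rewrite sub0r normrN ger0_norm ?normL2_ge0// => h.
have -> : (fun x => u t x - u t0 x - (t - t0) * v t0 x) =
    (fun x => (t - t0) * ((t - t0)^-1 * (u t x - u t0 x) - v t0 x)).
  by apply/funext => x; rewrite mulrBr mulVKf// subr_eq0.
by rewrite normL2Z// mulrC ler_wpM2r.
Qed.

Lemma L2cont_clamp u v : (forall t, t \in `[0, T] -> L2 (u t)) ->
  L2_time_derivative T u v -> L2cont (fun t => u (clamp T t)).
Proof.
move=> Lu duv; split=> [t|t0 e e0]; first exact/Lu/clamp_in.
set s0 := clamp T t0; have s0T : s0 \in `[0, T] by exact: clamp_in.
have [Lv _] := duv s0 s0T.
have [d d0 hd] := L2_time_derivative_error Lu duv s0T ltr01.
pose C := 1 + normL2 (v s0).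
have C0 : 0 < C by rewrite ltr_pwDl// normL2_ge0.
apply/nbhs_ballP; exists (Num.min d (e / C)); first by rewrite /= lt_min d0 divr_gt0.
move=> t; rewrite /ball/= lt_min distrC => /andP[td te].
set s := clamp T t; have sT : s \in `[0, T] by exact: clamp_in.
have ss0 : `|s - s0| <= `|t - t0| by exact: clamp_lip.
have h := hd s sT (le_lt_trans ss0 td).
have Lus : L2 (fun x => u s x - u s0 x) by apply: L2B; exact: Lu.
have Lvs : L2 (fun x => (s - s0) * v s0 x) by exact: L2Z.
have -> : (fun x => u s x - u s0 x) =
   (fun x => (u s x - u s0 x - (s - s0) * v s0 x) + (s - s0) * v s0 x).
  by apply/funext => x; rewrite subrK.
apply: le_trans (normL2D (L2B Lus Lvs) Lvs) _; rewrite normL2Z//.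
apply: (@le_trans _ _ (C * `|s - s0|)).
  by rewrite /C mulrDl (mulrC (normL2 _)) lerD.
rewrite mulrC -ler_pdivlMr//; apply: le_trans ss0 (ltW te).
Qed.

(** [0 < T] ensures that every point of [[0, T]] is an accumulation point. *)
Lemma L2_time_derivative_uniq u v w : (forall t, t \in `[0, T] -> L2 (u t)) ->
  L2_time_derivative T u v -> L2_time_derivative T u w ->
  forall t, t \in `[0, T] -> {ae mu, forall y, w t y = v t y}.
Proof.
move=> Lu duv duw t tT; have [Lv _] := duv t tT; have [Lw _] := duw t tT.
have Lwv := L2B Lw Lv.
suff /(normL2_eq0 Lwv) : normL2 (fun y => w t y - v t y) = 0.
  by apply: ae_imp => y /eqP; rewrite subr_eq0 => /eqP.
apply/eqP; rewrite eq_le normL2_ge0 andbT; apply/ler_addgt0Pr => e e0; rewrite add0r.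
have e20 : 0 < e / 2 by rewrite divr_gt0.
have [d1 d10 h1] := L2_time_derivative_error Lu duv tT e20.
have [d2 d20 h2] := L2_time_derivative_error Lu duw tT e20.
have [s [sT st s1 s2]] : exists s,
    [/\ s \in `[0, T], s != t, `|s - t| < d1 & `|s - t| < d2].
  move: tT; rewrite in_itv/= => /andP[t0 tT].
  (* One of [t + a], [t - a] lies in [[0, T]], because [a <= T / 2]. *)
  pose a := Num.min (Num.min d1 d2) T / 2.
  have a0 : 0 < a by rewrite divr_gt0// !lt_min d10 d20.
  have ad : a < Num.min (Num.min d1 d2) T.
    by rewrite /a ltr_pdivrMr// ltr_pMr ?ltr1n// !lt_min d10 d20.
  move: ad; rewrite !lt_min => /andP[/andP[a1 a2] aT].
  have [tT2|tT2] := leP t (T / 2).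
    exists (t + a); rewrite in_itv/= addrAC subrr add0r gtr0_norm//; split=> //.
      apply/andP; split; first by rewrite addr_ge0// ltW.
      have : a <= T / 2 by rewrite /a ler_wpM2r// ge_min lexx orbT.
      lra.
    by rewrite -subr_eq0 addrAC subrr add0r gt_eqF.
  exists (t - a); rewrite in_itv/= addrAC subrr add0r normrN gtr0_norm//; split=> //.
    apply/andP; split; last by rewrite lerBlDr (le_trans tT)// lerDl ltW.
    have : a <= T / 2 by rewrite /a ler_wpM2r// ge_min lexx orbT.
    lra.
  by rewrite -subr_eq0 addrAC subrr add0r oppr_eq0 gt_eqF.
have st0 : 0 < `|s - t| by rewrite normr_gt0 subr_eq0.
rewrite -(ler_pM2l st0) -normL2Z//.
have Lus : L2 (fun x => u s x - u t x) by apply: L2B; exact: Lu.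
have Lvs : L2 (fun x => (s - t) * v t x) by exact: L2Z.
have Lws : L2 (fun x => (s - t) * w t x) by exact: L2Z.
have -> : (fun y => (s - t) * (w t y - v t y)) =
    (fun y => (u s y - u t y - (s - t) * v t y) - (u s y - u t y - (s - t) * w t y)).
  by apply/funext => y; ring.
apply: le_trans (normL2B (L2B Lus Lvs) (L2B Lus Lws)) _.
rewrite mulrC (splitr e) mulrDl; apply: lerD; [exact: h1|exact: h2].
Qed.

End evolution.

(** * The solution as the integral of its velocity *)
Section identification.
Variables (R : realType) (T : R).
Hypothesis T0 : 0 < T.
Local Notation mu := (@lebesgue_measure R).
Variables (u v w : R -> R -> R).
Hypothesis Lu : forall t, t \in `[0, T] -> L2 (u t).
Hypothesis duv : L2_time_derivative T u v.
Hypothesis jw : jcont setT w.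
Hypothesis vw : forall t, t \in `[0, T] -> v t = w t.

Let V t y := primitive (w^~ y) t.
Let cw y : continuous (w^~ y). Proof. by apply: (jcont_time jw). Qed.
Let jV : jcont setT V. Proof. exact: (jcont_primitive openT jw). Qed.
Let zT : (0 : R) \in `[0, T]. Proof. by rewrite in_itv/= lexx ltW. Qed.

(** The integral of the velocity is only known to be continuous in [x], hence
locally square integrable: the comparison is made on [[-n, n]]. *)
Section cutoff.
Variable n : nat.
Let chi : R -> R := \1_`[- n%:R, n%:R].
Let D t y := chi y * (u t y - u 0 y - V t y).

Let Lchi : L2 chi. Proof. exact: L2_indic. Qed.
Let mchi : measurable_fun setT chi. Proof. exact: L2_measurable. Qed.

Let chi1 y : `|chi y| <= 1.
Proof. by rewrite /chi indicE; case: (_ \in _); rewrite /= ?normr1 ?normr0. Qed.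

Let cV t : continuous (V t).
Proof. by move=> x; exact: (@jcont_space _ _ _ t x jV I). Qed.

Let chi_mul (h : R -> R) C : measurable_fun setT h ->
  (forall y, - n%:R <= y <= n%:R -> `|h y| <= C) -> 0 <= C ->
  L2 (fun y => chi y * h y) /\ normL2 (fun y => chi y * h y) <= C * normL2 chi.
Proof.
move=> mh hC C0.
have m : measurable_fun setT (fun y => chi y * h y) by exact: measurable_funM.
have LC : L2 (fun y => C * chi y) by exact: L2Z.
have le y : `|chi y * h y| <= `|C * chi y|.
  rewrite !normrM mulrC (ger0_norm C0) /chi indicE.
  have [yn|_] := boolP (y \in _); last by rewrite normr0 !mulr0.
  rewrite ler_wpM2r// hC//; move: yn; rewrite inE/= in_itv; exact.
split; first exact: L2_le LC le.
by apply: le_trans (normL2_le m LC le) _; rewrite normL2Z// (ger0_norm C0).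
Qed.

Let chi_L2 (h : R -> R) : L2 h ->
  L2 (fun y => chi y * h y) /\ normL2 (fun y => chi y * h y) <= normL2 h.
Proof.
move=> Lh; have m : measurable_fun setT (fun y => chi y * h y).
  by apply: measurable_funM => //; exact: L2_measurable.
have le y : `|chi y * h y| <= `|h y| by rewrite normrM ler_piMl.
by split; [exact: L2_le Lh le|exact: normL2_le].
Qed.

Let LD t : t \in `[0, T] -> L2 (D t).
Proof.
move=> tT.
have -> : D t = (fun y => chi y * (u t y - u 0 y) - chi y * V t y).
  by apply/funext => y; rewrite /D mulrBr.
apply: L2B; first by apply: (chi_L2 _).1; apply: L2B; exact: Lu.
have [C C0 hC] :=
  compact_bounded_fun (@segment_compact R (- n%:R) n%:R) (fun y _ => @cV t y).
apply: (@chi_mul _ C _ _ C0).1; first exact: continuous_measurable_fun.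
by move=> y yn; apply: hC; rewrite /= in_itv.
Qed.

(** The curve [D] has zero derivative in [L^2]: [u] and [V] have the same
derivative [w s0] at [s0], the former in [L^2] and the latter uniformly on
compact sets. *)
Let D_diff s0 e : s0 \in `[0, T] -> 0 < e -> exists2 d : R, 0 < d &
  forall s, s \in `[0, T] -> `|s - s0| < d ->
    `|normL2 (D s) - normL2 (D s0)| <= e * `|s - s0|.
Proof.
move=> s0T e0; have [Lv _] := duv s0T.
have e20 : 0 < e / 2 by rewrite divr_gt0.
pose e1 := e / 2 / (normL2 chi + 1).
have nc : 0 < normL2 chi + 1 by rewrite ltr_wpDl// normL2_ge0.
have e10 : 0 < e1 by rewrite divr_gt0.
have [d1 d10 h1] := L2_time_derivative_error Lu duv s0T e20.
have cK := @segment_compact R (- n%:R) n%:R.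
have /nbhs_ballP[d2 /= d20 h2] := jcont_unif_time s0 jw cK (@subsetT _ _) e10.
exists (Num.min d1 d2); first by rewrite lt_min d10.
move=> s sT; rewrite lt_min => /andP[sd1 sd2].
apply: le_trans (normL2_dist (LD sT) (LD s0T)) _.
pose p y := u s y - u s0 y - (s - s0) * v s0 y.
pose q y := V s y - V s0 y - (s - s0) * w s0 y.
have Lp : L2 p.
  by apply: L2B; [apply: L2B; exact: Lu|exact: L2Z].
have mq : measurable_fun setT q.
  apply: continuous_measurable_fun => y.
  apply: cvgB; first by apply: cvgB; exact: cV.
  by apply: cvgMr; exact: (@jcont_space _ _ _ s0 y jw I).
have qle y : - n%:R <= y <= n%:R -> `|q y| <= e1 * `|s - s0|.
  move=> yn.
  have := @mvt_bound R (fun t => V t y - t * w s0 y)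
    (fun t => w t y - w s0 y) s0 s e1 _ _.
  rewrite (_ : _ - _ - _ = q y); last by rewrite /q; ring.
  apply=> t /between_norm ts.
    by apply: is_deriveB; [apply: is_derive_primitive; exact: cw|exact: is_derive_mulr].
  apply: ltW; apply: h2; last by rewrite /= in_itv.
  by rewrite /ball/= distrC; exact: le_lt_trans ts sd2.
have [Lcq ncq] := chi_mul mq qle (mulr_ge0 (ltW e10) (normr_ge0 _)).
have [Lcp ncp] := chi_L2 Lp.
have -> : (fun y => D s y - D s0 y) = (fun y => chi y * p y - chi y * q y).
  by apply/funext => y; rewrite /D /p /q (vw s0T); ring.
apply: le_trans (normL2B Lcp Lcq) _.
apply: (@le_trans _ _ (e / 2 * `|s - s0| + e1 * `|s - s0| * normL2 chi)).
  by apply: lerD => //; apply: le_trans ncp _; exact: h1.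
rewrite [X in _ <= X * _](splitr e) [leRHS]mulrDl lerD2l mulrAC ler_wpM2r//.
rewrite /e1 mulrAC ler_pdivrMr//; apply: ler_wpM2l; first exact: ltW.
by rewrite lerDl.
Qed.

Lemma cutoff_eq t : t \in `[0, T] ->
  {ae mu, forall y, - n%:R <= y <= n%:R -> u t y = u 0 y + V t y}.
Proof.
move=> tT.
have dh (r : R) : is_derive r (1 : R) (fun r => normL2 (D (clamp T r))) 0.
  apply/is_derive_eps => e e0.
  have [d d0 hd] := D_diff (clamp_in T0 r) e0.
  apply/nbhs_ballP; exists d => // z; rewrite /ball/= distrC => zr.
  have zr' := clamp_lip T0 z r.
  rewrite mulr0 subr0 (le_trans (hd _ (clamp_in T0 _) (le_lt_trans zr' zr)))//.
  by rewrite ler_wpM2l// ltW.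
have D0 : normL2 (D 0) = 0.
  rewrite (_ : D 0 = fun y => 0 * chi y); first by rewrite normL2Z// normr0 mul0r.
  by apply/funext => y; rewrite /D /V primitive0 subr0 subrr mulr0 mul0r.
have := is_derive_0_is_cst t 0 dh; rewrite !clamp_id// D0 => /(normL2_eq0 (LD tT)).
apply: ae_imp => y; rewrite /D /chi indicE => + yn.
rewrite mem_set ?mul1r; last by rewrite /= in_itv.
by move=> /eqP; rewrite -addrA -opprD subr_eq0 => /eqP.
Qed.

End cutoff.

Lemma L2_integral_eq t : t \in `[0, T] ->
  {ae mu, forall y, u t y = u 0 y + primitive (w^~ y) t}.
Proof.
move=> tT.
have := ae_foralln (fun n => cutoff_eq n tT).
apply: ae_imp => y h.
apply: (h (Num.bound `|y|)).
by rewrite -ler_norml ltW// archi_boundP.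
Qed.

End identification.

(** * Regularity of the velocity and conclusion *)
Lemma CtC_clamp (R : realType) (O : set R) (T : R) m (f : R -> R -> R) :
  0 < T -> CtC O m f -> CtC O m (fun t => f (clamp T t)).
Proof.
move=> T0.
have jc (h : R -> R -> R) : jcont O h -> jcont O (fun t => h (clamp T t)).
  move=> /jcontP jh; apply/jcontP => t x Ox e e0.
  have [d d0 hd] := jh (clamp T t) x Ox e e0.
  exists d => // s y st yx; apply: hd => //.
  exact: le_lt_trans (clamp_lip T0 _ _) st.
elim: m f => [|m ih] f [jf Cf]; split=> //; try exact: jc.
have [f' df Cf'] := Cf; exists (fun t => f' (clamp T t)); last exact: ih.
by move=> t x Ox; exact: df.
Qed.

Lemma jcont_setT (R : realType) (O : set R) (f : R -> R -> R) :
  jcont setT f -> jcont O f.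
Proof. by move=> jf t x _; exact: jf. Qed.

Section bootstrap.
Variables (R : realType) (O : set R) (k : nat) (theta T : R).
Hypotheses (oO : open O) (T0 : 0 < T).
Variables (g0 : R -> R) (u : R -> R -> R).
Hypothesis Cg0 : Cktheta k theta O g0.
Hypothesis cu : L2cont (fun t => u (clamp T t)).

Let w t x := - dhelmholtz_inv (flux (u (clamp T t))) x.
Let V t x := primitive (w^~ x) t.

Hypothesis uV : forall t, t \in `[0, T] -> ae_eq_on O (u t) (fun y => g0 y + V t y).

Lemma jcont_velocity : jcont setT w.
Proof.
move=> t x _; apply: cvgN; exact: (jcont_dhelmholtz_inv cu).
Qed.

(** On [O], [w t] has derivative [G t - H t], where [G] is the flux of
the representative [U] of [u] and [H] the convolution.  [G] inherits the
regularity of [U], that is of [g0] and of the time integral of [w], and [H] has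
derivative [- w]; so if [w] has [m <= k] continuous derivatives, it has one
more. *)
Lemma CtC_velocity m : (m <= k.+1)%N -> CtC O m w.
Proof.
elim: m => [|m ih] mk.
  by split=> //; apply: jcont_setT; exact: jcont_velocity.
have Cw := ih (ltnW mk).
have CV : CtC O m V by exact: CtC_primitive.
pose U t y := g0 y + V (clamp T t) y.
have CU : CtC O m U.
  apply: (@CtCD _ _ _ (fun=> g0)); last exact: (CtC_clamp T0 CV).
  by apply: (CtC_Cktheta Cg0); rewrite -ltnS.
pose G t := flux (U t).
have CG : CtC O m G.
  have -> : G = (fun t y => U t y + 2^-1 * (U t y * U t y)).
    by apply/funext => t; apply/funext => y; rewrite /G /flux expr2 [_ / 2]mulrC.
  by apply: CtCD => //; apply: CtCZ; exact: CtCM.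
pose H t := helmholtz_inv (flux (u (clamp T t))).
have CH : CtC O m H.
  apply: CtCW; split; first by apply: jcont_setT; exact: jcont_helmholtz_inv.
  exists (fun t x => -1 * w t x); last exact: CtCZ.
  move=> t x Ox; rewrite mulN1r opprK.
  by apply: is_derive_helmholtz_inv; apply: exp_integrable_flux; exact: cu.1.
split; first by apply: jcont_setT; exact: jcont_velocity.
exists (fun t x => G t x + -1 * H t x); last by apply: CtCD => //; exact: CtCZ.
move=> t x Ox; rewrite mulN1r -opprB; apply: is_deriveN.
apply: (is_derive_dhelmholtz_inv oO Ox).
- by apply: exp_integrable_flux; exact: cu.1.
- have := uV (clamp_in T0 t); apply: ae_imp => y uy Oy.
  by rewrite /G /flux /U uy.
- by apply: jcont_space Ox; exact: CtC_jcont CG.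
Qed.

End bootstrap.

(** In the difference of two values of the curve [g0 + f] the function [g0]
cancels, so that its Hoelder continuity of order [theta] is enough, although it
would not give convergence by itself. *)
Lemma CtC_C_Cktheta (R : realType) (O : set R) (k : nat) (theta T : R)
    (g0 : R -> R) (f u : R -> R -> R) :
  open O -> 0 <= theta <= 1 -> Cktheta k theta O g0 -> CtC O k.+1 f ->
  (forall t, t \in `[0, T] -> ae_eq_on O (u t) (fun y => g0 y + f t y)) ->
  C_Cktheta T k theta O u.
Proof.
move=> oO th Cg Cf uf; exists (fun t y => g0 y + f t y) => t0 t0T; split.
- apply: (CktthetaD oO) => //; exact: (CtC_Cktheta_val oO).
- exact: uf.
- move=> K cK K0 KO.
  have CD : CtC O k.+1 (fun t x => f t x + -1 * f t0 x).
    by apply: CtCD => //; apply: CtCZ; exact: CtC_freeze.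
  have D0 : f t0 \+ (fun x => -1 * f t0 x) = fun=> 0.
    by apply/funext => x /=; rewrite mulN1r subrr.
  have h := CtC_Cktheta_cvg oO th CD D0 cK K0 KO.
  apply: cvg_within_filter.
  rewrite [X in X @ _ --> _](_ : _ =
      (fun t => Cktheta_norm k theta K (fun x => f t x + -1 * f t0 x)))//.
  apply/funext => t; congr Cktheta_norm.
  by apply/funext => x /=; rewrite mulN1r opprD addrACA subrr add0r.
Qed.

Theorem theorem1p6 (R : realType) (s : R) (hs : 0 <= s)
    (u0 : R -> R) (hu0 : Hs s u0)
    (k : nat) (theta : R) (htheta0 : 0 <= theta) (htheta1 : theta < 1)
    (Omega : set R) (hOmega : open Omega)
    (hreg : has_Cktheta_rep k theta Omega u0)
    (T : R) (hT : 0 < T) (u : R -> R -> R) (hu : bbm_solution T s u0 u)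
    (ut : R -> R -> R) (hut : L2_time_derivative T u ut) :
  (forall t : R, t \in `[0, T] -> has_Cktheta_rep k theta Omega (u t)) /\
  C_Cktheta T k theta Omega u /\
  C_Cktheta T k theta Omega ut.
Proof.
have th : 0 <= theta <= 1 by rewrite htheta0 ltW.
have [g0 Cg0 u0g0] := hreg.
have [uHs uu0 duv] := hu.
have Lu t : t \in `[0, T] -> L2 (u t) by move=> /uHs[[]].
(* The velocity [w] is defined for all times and equals the right-hand side of
the equation at every point, not only almost everywhere. *)
have cu := L2cont_clamp hT Lu duv.
pose w t x := - dhelmholtz_inv (flux (u (clamp T t))) x.
have vw t : t \in `[0, T] -> bbm_rhs (u t) = w t.
  by move=> tT; apply/funext => x; rewrite (bbm_rhsE _ (Lu _ tT)) /w (clamp_id tT).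
have jw : jcont setT w by exact: jcont_velocity.
have uV t : t \in `[0, T] ->
    ae_eq_on Omega (u t) (fun y => g0 y + primitive (w^~ y) t).
  move=> tT; have h1 := L2_integral_eq hT Lu duv jw vw tT.
  have h2 : ae_eq_on Omega (u 0) g0.
    by apply: ae_imp2 uu0 u0g0 => y /(_ I) -> h /h.
  by apply: ae_imp2 h1 h2 => y -> h /h ->.
have Cw : CtC Omega k.+1 w by exact: (CtC_velocity hOmega hT Cg0 cu uV).
have Cu := CtC_C_Cktheta hOmega th Cg0 (CtC_primitive hOmega Cw) uV.
split=> [t tT|]; first by have [U /(_ t tT)[CU uU _]] := Cu; exists (U t).
split=> //.
have C0 : Cktheta k theta Omega (fun=> 0).
  exact: (CtC_Cktheta_val hOmega 0 th (CtC_cst Omega k.+1 0)).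
apply: (CtC_C_Cktheta hOmega th C0 Cw) => t tT.
have := L2_time_derivative_uniq hT Lu duv hut tT.
by apply: ae_imp => y -> _; rewrite add0r vw.
Qed.
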